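(* For each $t>0$, $$ \dim X_S([0,t])=\mathrm{Dim}\, X_S([0,t])=0 $$ almost surely, where $\dim$ and $\mathrm{Dim}$ are the Hausdorff and packing dimensions of subsets of $S$ with respect to the ultrametric $\Delta$, and $X_S([0,t])=\{X_S(s):\ 0\le s\le t\}$.
   Context: Fields. Let $k$ be a non-Archimedean local field of characteristic zero and let $k=K_1\subset K_2\subset\cdots\subset K_n\subset\cdots$ be a strictly increasing sequence of finite extensions, $K=\bigcup_{n\ge1}K_n$. For each $n$: $|\cdot|_n$ is the normalized absolute value of $K_n$; $q_n$ is the residue field cardinality of $K_n$; $m_n=[K_n:k]$; $f_n$ is the inertia index of $K_n/k$; $d_n$ is the exponent of the different of $K_n/k$, i.e. the largest integer $d$ such that $|\mathrm{Tr}_{K_n/k}(x)|_1\le1$ for all $x\in K_n$ with $|x|_n\le q_n^{d}$. $\|\cdot\|$ is the absolute value on $K$ extending $|\cdot|_1$, i.e. $\|x\|=|x|_n^{1/m_n}$ for $x\in K_n$. The maps $T_n$ and the space $\overline{K}$. $T_n:K\to K_n$ is defined by $T_n(x)=\frac{m_n}{m_\nu}\mathrm{Tr}_{K_\nu/K_n}(x)$ for $x\in K_\nu$, $\nu>n$, and $T_n(x)=x$ for $x\in K_n$; it is well defined; $T=T_1$. $\overline{K}$ is the projective limit of $\{K_n\}$ with respect to $\{T_n\}$: the set of $x=(x_1,x_2,\ldots)\in\prod_n K_n$ with $x_n=T_n(x_\nu)$ for $\nu>n$, with the topology given by the seminorms $\|x\|_n=\|x_n\|$. For $x\in\overline{K}$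 put $T_n(x)=x_n$. The pairing between $K$ and $\overline{K}$ is $\langle x,y\rangle=T(xy_n)$ for $x\in K_n\subset K$, $y=(y_1,y_2,\ldots)\in\overline{K}$ (independent of the choice of $n$ with $x\in K_n$). Subgroups. $S=\{x\in\overline{K}:\ \|T_n(x)\|\le q_n^{d_n/m_n}\|m_n\|,\ n=1,2,\ldots\}$, a compact subgroup of $\overline{K}$ (here $\|m_n\|$ is the absolute value of the integer $m_n$ viewed in $k$). $S_0=S$ and $S_n=\{x\in S:\ \|T_n(x)\|\le q_n^{d_n/m_n-n/f_n}\|m_n\|\}$ for $n\ge1$; these form a descending chain of open compact subgroups of $S$ which is a base of neighbourhoods of $0$ in $S$. Metric on $S$. $M(n)$ is the order of the finite group $S/S_n$; $M(n)=q_1^{nm_n}$ for $n\ge1$. For $x\in S$ set $|x|=1$ if $x\notin S_1$, $|x|=[M(n)]^{-1}$ if $x\in S_n\setminus S_{n+1}$, $n\ge1$, and $|0|=0$; the ultrametric on $S$ is $\Delta(x,y)=|x-y|$. Process. Let $\chi$ be a rank zero additive character of $k$ (a continuous unitary character trivial on $\{|x|_1\le1\}$ but not on $\{|x|_1\le q_1\}$). For a fixed $\alpha>0$ there is a convolution semigroup $\pi(t,dx)$, $t>0$, of Radon probability measures on $\overline{K}$, concentrated on $S$, with $\int_{\overline{K}}\chi(\langle\xi,x\rangle)\,\pi(t,dx)=e^{-t\|\xi\|^\alpha}$ if $\xi\in K$, $\|\xi\|>1$, and $=1$ if $\xi\in K$, $\|\xi\|\le1$. $X_S(t)$ is the Lévy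 process on the compact group $S$ (stationary independent increments, $X_S(0)=0$, right-continuous paths with left limits) with $X_S(t)$ distributed according to $\pi(t,\cdot)$. *)

(* Defs.v *)
From HB Require Import structures.
From mathcomp Require Import all_boot all_order all_algebra.
From mathcomp Require Import finmap complex.
From mathcomp Require Import all_classical all_reals all_analysis.

Set Implicit Arguments.
Unset Strict Implicit.
Unset Printing Implicit Defensive.

Import Order.TTheory GRing.Theory Num.Theory.
Import numFieldTopology.Exports numFieldNormedType.Exports.

Local Open Scope classical_set_scope.
Local Open Scope ring_scope.

(* All fields are subfields of one field [K], given as predicates on [K]. *)

Section FiniteExtensions.
Variable K : fieldType.
Implicit Types F E : {pred K}.

Definition is_basis F E d (b : 'I_d -> K) : Prop :=
  [/\ forall i, b i \in E,
      forall a : 'I_d -> K, (forall i, a i \in F) ->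
        \sum_i a i * b i = 0 -> forall i, a i = 0
    & forall x, x \in E ->
        exists2 a : 'I_d -> K, forall i, a i \in F & x = \sum_i a i * b i].

(* [t] is the trace of the [F]-linear map [y |-> x * y] of [E]. *)
Definition is_trace F E (x t : K) : Prop :=
  exists d (b : 'I_d -> K) (A : 'M[K]_d),
    [/\ is_basis F E b,
        forall i j, A i j \in F,
        forall i, x * b i = \sum_j A i j * b j
      & t = \tr A].

(* Unique by [is_trace_uniq] below; 0 if [E] is not finite over [F]. *)
Definition ext_trace F E (x : K) : K := xget 0 [set t | is_trace F E x t].

Section TraceTheory.
Variables F E : {pred K}.
Hypotheses (hF : GRing.divring_closed F) (hE : GRing.divring_closed E).

Let F1 : 1 \in F. Proof. by case: hF. Qed.
Let FB x y : x \in F -> y \in F -> x - y \in F.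
Proof. by case: hF => _ h _; exact: h. Qed.
Let F0 : 0 \in F. Proof. by rewrite -(subrr 1) FB. Qed.
Let FD x y : x \in F -> y \in F -> x + y \in F.
Proof. by move=> hx hy; rewrite -[y]opprK FB// -sub0r FB. Qed.
Let FM x y : x \in F -> y \in F -> x * y \in F.
Proof.
move=> hx hy; case: hF => _ _ h; rewrite -[y]invrK h//.
by rewrite -[_^-1]mul1r h.
Qed.
Let EM x y : x \in E -> y \in E -> x * y \in E.
Proof.
move=> hx hy; case: hE => h1 _ h; rewrite -[y]invrK h//.
by rewrite -[_^-1]mul1r h.
Qed.

Let Fmulmx m n p (A : 'M[K]_(m, n)) (B : 'M[K]_(n, p)) :
  (forall i j, A i j \in F) -> (forall i j, B i j \in F) ->
  forall i j, (A *m B) i j \in F.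
Proof.
move=> hA hB i j; rewrite mxE.
by apply: (big_ind (fun y => y \in F)) => // k _; apply: FM.
Qed.

Let basis_free d (b : 'I_d -> K) m (A B : 'M[K]_(m, d)) : is_basis F E b ->
  (forall i j, A i j \in F) -> (forall i j, B i j \in F) ->
  A *m (\col_i b i) = B *m (\col_i b i) -> A = B.
Proof.
move=> [_ free _] hA hB AB; apply/matrixP => i j; apply/eqP.
rewrite -subr_eq0; apply/eqP.
apply: (free (fun j => A i j - B i j)) => [k|]; first exact: FB.
under eq_bigr do rewrite mulrBl.
rewrite sumrB; have /matrixP/(_ i ord0) := AB; rewrite !mxE => AB'.
apply/eqP; rewrite subr_eq0; apply/eqP.
by move: AB'; under eq_bigr do rewrite mxE;
  under [in RHS]eq_bigr do rewrite mxE.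
Qed.

Let basis_span d (b : 'I_d -> K) m (c : 'I_m -> K) : is_basis F E b ->
  (forall i, c i \in E) ->
  exists2 P : 'M[K]_(m, d), forall i j, P i j \in F
    & (\col_i c i) = P *m (\col_i b i).
Proof.
move=> [_ _ span] hc.
have /choice[a ha] : forall i, exists a : 'I_d -> K,
    (forall j, a j \in F) /\ c i = \sum_j a j * b j.
  by move=> i; have [a] := span _ (hc i); exists a.
exists (\matrix_(i, j) a i j) => [i j|].
  by rewrite mxE; exact: (ha i).1.
apply/matrixP => i j; rewrite !mxE (ha i).2.
by apply: eq_bigr => k _; rewrite !mxE.
Qed.

Let trace_mx d (b : 'I_d -> K) (A : 'M[K]_d) x :
  (forall i, x * b i = \sum_j A i j * b j) <->
  x *: (\col_i b i) = A *m (\col_i b i).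
Proof.
split=> [h|/matrixP h i].
  apply/matrixP => i j; rewrite !mxE h.
  by apply: eq_bigr => k _; rewrite mxE.
have := h i ord0; rewrite !mxE => ->.
by apply: eq_bigr => k _; rewrite mxE.
Qed.

Lemma is_trace_uniq x t t' :
  is_trace F E x t -> is_trace F E x t' -> t = t'.
Proof.
move=> [d [b [A [hb hA /trace_mx xA ->]]]].
move=> [d' [b' [A' [hb' hA' /trace_mx xA' ->]]]].
have [bE _ _] := hb; have [b'E _ _] := hb'.
have [P hP eP] := basis_span hb b'E.
have [Q hQ eQ] := basis_span hb' bE.
have QP : Q *m P = 1%:M.
  apply: (basis_free hb); first exact: Fmulmx.
    by move=> i j; rewrite mxE; case: eqP.
  by rewrite mul1mx -mulmxA -eP.
have -> : A' = P *m A *m Q.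
  apply: (basis_free hb') => //.
    by apply: Fmulmx => //; exact: Fmulmx.
  by rewrite -xA' -mulmxA -eQ -mulmxA -xA eP scalemxAr.
by rewrite mxtrace_mulC mulmxA QP mul1mx.
Qed.

Lemma ext_traceP x t : is_trace F E x t -> ext_trace F E x = t.
Proof.
move=> h; apply: (is_trace_uniq (x := x)) => //.
by rewrite /ext_trace; case: xgetP => [? -> //|/(_ t)].
Qed.

Lemma is_trace_ext d (b : 'I_d -> K) x : is_basis F E b -> x \in E ->
  is_trace F E x (ext_trace F E x).
Proof.
move=> hb xE; have [bE _ _] := hb.
have xbE i : x * b i \in E by exact: EM.
have [A hA eA] := basis_span hb xbE.
have h : is_trace F E x (\tr A).
  exists d, b, A; split => //; apply/trace_mx; rewrite -eA.
  by apply/matrixP => i j; rewrite !mxE.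
by rewrite (ext_traceP h).
Qed.

Lemma ext_traceB x y : x \in E -> y \in E ->
  ext_trace F E (x - y) = ext_trace F E x - ext_trace F E y.
Proof.
move=> xE yE.
have [[d [b hb]]|nb] := pselect (exists d (b : 'I_d -> K), is_basis F E b).
  have [bE _ _] := hb.
  have xbE i : x * b i \in E by exact: EM.
  have ybE i : y * b i \in E by exact: EM.
  have [A hA eA] := basis_span hb xbE.
  have [B hB eB] := basis_span hb ybE.
  have xA : x *: (\col_i b i) = A *m (\col_i b i).
    by rewrite -eA; apply/matrixP => i j; rewrite !mxE.
  have yB : y *: (\col_i b i) = B *m (\col_i b i).
    by rewrite -eB; apply/matrixP => i j; rewrite !mxE.
  rewrite (@ext_traceP x (\tr A)); last first.
    by exists d, b, A; split => //; apply/trace_mx.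
  rewrite (@ext_traceP y (\tr B)); last first.
    by exists d, b, B; split => //; apply/trace_mx.
  apply: ext_traceP; exists d, b, (A - B); split => //.
  - by move=> i j; rewrite !mxE FB.
  - by apply/trace_mx; rewrite scalerBl mulmxBl xA yB.
  - by rewrite raddfB.
have tr0 z : ext_trace F E z = 0.
  rewrite /ext_trace; case: xgetP => // t _ [d [b [A [hb _ _ _]]]].
  by case: nb; exists d, b.
by rewrite !tr0 subrr.
Qed.

End TraceTheory.
End FiniteExtensions.

Definition cosets (V : zmodType) (A B : set V) : set (set V) :=
  [set [set x + y | y in B] | x in A].

(* The order of [A / B] when this quotient is finite, 0 otherwise. *)
Definition coset_index (V : zmodType) (A B : set V) : nat :=
  #|` fset_set (cosets A B)|.

Section LocalFields.
Variables (R : realType) (K : fieldType).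
Implicit Types (F E : {pred K}) (abs : K -> R).

Definition valuation_ring F abs : set K := [set x | x \in F /\ abs x <= 1].
Definition valuation_ideal F abs : set K := [set x | x \in F /\ abs x < 1].
Definition residue_field F abs : set (set K) :=
  cosets (valuation_ring F abs) (valuation_ideal F abs).
Definition residue_card F abs : nat :=
  coset_index (valuation_ring F abs) (valuation_ideal F abs).

(* [F] is a non-Archimedean local field and [abs] (restricted to [F]) its
   normalized absolute value: a uniformizer has absolute value
   [1 / residue_card]. *)
Record is_local_field F abs : Prop := IsLocalField {
  lf_subfield : GRing.divring_closed F;
  lf_abs_ge0 : forall x, x \in F -> 0 <= abs x;
  lf_abs_eq0 : forall x, x \in F -> abs x = 0 <-> x = 0;
  lf_absM : forall x y, x \in F -> y \in F -> abs (x * y) = abs x * abs y;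
  lf_absD : forall x y, x \in F -> y \in F ->
    abs (x + y) <= Num.max (abs x) (abs y);
  lf_complete : forall u : nat -> K, (forall i, u i \in F) ->
    (forall e : R, 0 < e -> exists N, forall i j,
       (N <= i)%N -> (N <= j)%N -> abs (u i - u j) < e) ->
    exists2 l, l \in F & forall e : R, 0 < e -> exists N, forall i,
       (N <= i)%N -> abs (u i - l) < e;
  lf_residue_finite : finite_set (residue_field F abs);
  lf_value_group : forall x, x \in F -> x != 0 ->
    exists z : int, abs x = (residue_card F abs)%:R ^ z;
  lf_uniformizer :
    exists2 p, p \in F & abs p = (residue_card F abs)%:R^-1
}.

(* The classes of the [b i] form a basis of the residue field of [E] over that
   of [F], where [abs] is an absolute value on [E]. *)
Definition is_residue_basis F E abs f (b : 'I_f -> K) : Prop :=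
  [/\ forall i, valuation_ring E abs (b i),
      forall a : 'I_f -> K, (forall i, valuation_ring F abs (a i)) ->
        valuation_ideal E abs (\sum_i a i * b i) ->
        forall i, valuation_ideal F abs (a i)
    & forall x, valuation_ring E abs x ->
        exists2 a : 'I_f -> K, forall i, valuation_ring F abs (a i)
          & valuation_ideal E abs (x - \sum_i a i * b i)].

(* [d] is the exponent of the different of [E / F], with [absF] and [absE] the
   normalized absolute values. *)
Definition is_different_exponent F E (absF absE : K -> R) (d : int) : Prop :=
  let bounded_trace (c : int) := forall x, x \in E ->
    absE x <= (residue_card E absE)%:R ^ c -> absF (ext_trace F E x) <= 1 in
  bounded_trace d /\ forall c, bounded_trace c -> c <= d.

End LocalFields.

(* Indices start from 0: [tK i], [tabs i], ... stand for K_{i+1}, |.|_{i+1}, ...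
   and [tK tw 0] is the base field k; likewise [kseq x i] below is x_{i+1}. *)
Record tower (R : realType) (K : fieldType) := Tower {
  tK : nat -> {pred K};
  tabs : nat -> K -> R;
  tnorm : K -> R;
  tdeg : nat -> nat;
  tinert : nat -> nat;
  tdiff : nat -> int;
  tower_char0 : [pchar K] =i pred0;
  tower_local : forall i, is_local_field (tK i) (tabs i);
  tower_sub : forall i, {subset tK i <= tK i.+1};
  tower_strict : forall i, exists2 x, x \in tK i.+1 & x \notin tK i;
  tower_union : forall x, exists i, x \in tK i;
  tower_deg : forall i,
    exists b : 'I_(tdeg i) -> K, is_basis (tK 0) (tK i) b;
  tower_inert : forall i,
    exists b : 'I_(tinert i) -> K, is_residue_basis (tK 0) (tK i) (tabs i) b;
  tower_diff : forall i,
    is_different_exponent (tK 0) (tK i) (tabs 0) (tabs i) (tdiff i);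
  tower_norm : forall i x, x \in tK i ->
    tnorm x = tabs i x `^ (tdeg i)%:R^-1
}.

Section Tower.
Variables (R : realType) (K : fieldType) (tw : tower R K).

Definition tq (i : nat) : nat := residue_card (tK tw i) (tabs tw i).

(* The restriction of T_i : K -> K_i to [tK tw j], for [i <= j]. On [tK tw i]
   it is the identity, and these maps are compatible as [j] varies. *)
Definition Tmap (j i : nat) (x : K) : K :=
  (tdeg tw i)%:R / (tdeg tw j)%:R * ext_trace (tK tw i) (tK tw j) x.

Lemma TmapB j i x y : x \in tK tw j -> y \in tK tw j ->
  Tmap j i (x - y) = Tmap j i x - Tmap j i y.
Proof.
move=> xj yj; rewrite /Tmap ext_traceB ?mulrBr//;
  exact: lf_subfield (tower_local tw _).
Qed.

Definition Kbar_pred : {pred nat -> K} := fun x =>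
  `[< (forall i, x i \in tK tw i) /\
      (forall i j, (i < j)%N -> x i = Tmap j i (x j)) >].

Lemma Kbar_zmod_closed : GRing.zmod_closed Kbar_pred.
Proof.
have K0 i : 0 \in tK tw i.
  have [h1 hB _] := lf_subfield (tower_local tw i).
  by rewrite -(subrr 1); exact: hB.
split.
  apply/asboolP; split=> [i|i j _]; first exact: K0.
  by rewrite -[X in Tmap _ _ X](subrr 0) TmapB// subrr.
move=> x y /asboolP[hx Tx] /asboolP[hy Ty]; apply/asboolP; split=> [i|i j ij].
  by have [_ hB _] := lf_subfield (tower_local tw i); exact: hB.
rewrite TmapB//; exact: (congr2 (fun a b => a - b) (Tx _ _ ij) (Ty _ _ ij)).
Qed.

HB.instance Definition _ :=
  GRing.isZmodClosed.Build (nat -> K) Kbar_pred Kbar_zmod_closed.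

End Tower.

Record Kbar (R : realType) (K : fieldType) (tw : tower R K) :=
  MkKbar { kseq : nat -> K; _ : kseq \in Kbar_pred tw }.

Section KbarStructures.
Variables (R : realType) (K : fieldType) (tw : tower R K).

HB.instance Definition _ := [isSub for @kseq R K tw].
HB.instance Definition _ := [Choice of Kbar tw by <:].
HB.instance Definition _ := [SubChoice_isSubZmodule of Kbar tw by <:].
HB.instance Definition _ := isPointed.Build (Kbar tw) 0.

(* The topology of the seminorms [x |-> tnorm tw (kseq x i)]. *)
Definition Kbar_open : set (set (Kbar tw)) := [set U | forall x, U x ->
  exists N (e : R), 0 < e /\ forall y : Kbar tw,
    (forall i, (i <= N)%N -> tnorm tw (kseq y i - kseq x i) < e) -> U y].

Lemma Kbar_openT : Kbar_open setT.
Proof. by move=> x _; exists 0%N, 1. Qed.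

Lemma Kbar_openI : setI_closed Kbar_open.
Proof.
move=> U V oU oV x [/oU[N [e [e0 hU]]] /oV[M [f [f0 hV]]]].
exists (maxn N M), (Num.min e f); split; first by rewrite lt_min e0.
move=> y hy; split; [apply: hU|apply: hV] => i hi.
- by have := hy i; rewrite leq_max hi lt_min => /(_ isT)/andP[].
- by have := hy i; rewrite leq_max hi orbT lt_min => /(_ isT)/andP[].
Qed.

Lemma Kbar_open_bigU (I : Type) (f : I -> set (Kbar tw)) :
  (forall i, Kbar_open (f i)) -> Kbar_open (\bigcup_i f i).
Proof.
move=> opf x [i _ /opf[N [e [e0 h]]]]; exists N, e; split => // y hy.
by exists i => //; exact: h.
Qed.

HB.instance Definition _ := isOpenTopological.Build (Kbar tw)
  Kbar_openT Kbar_openI Kbar_open_bigU.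

(* The Borel sigma-algebra. *)
HB.instance Definition _ := Measurable.copy (Kbar tw)
  (g_sigma_algebraType (@open (Kbar tw))).

End KbarStructures.

Section GroupS.
Variables (R : realType) (K : fieldType) (tw : tower R K).

(* Independent of [i] such that [xi \in tK tw i]. *)
Definition pairing (i : nat) (xi : K) (x : Kbar tw) : K :=
  Tmap tw i 0 (xi * kseq x i).

Definition S0 : set (Kbar tw) := [set x | forall i,
  tnorm tw (kseq x i) <=
    (tq tw i)%:R `^ ((tdiff tw i)%:~R / (tdeg tw i)%:R)
    * tnorm tw (tdeg tw i)%:R].

(* Here [n] is the index of the subgroup as in S_n; it involves the field K_n,
   that is [tK tw n.-1]. *)
Definition Ssub (n : nat) : set (Kbar tw) :=
  if n is i.+1 then
    S0 `&` [set x | tnorm tw (kseq x i) <=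
      (tq tw i)%:R `^ ((tdiff tw i)%:~R / (tdeg tw i)%:R
                       - n%:R / (tinert tw i)%:R)
      * tnorm tw (tdeg tw i)%:R]
  else S0.

Definition Sindex (n : nat) : nat := coset_index S0 (Ssub n).

(* Only meaningful on S. *)
Definition Sabs (x : Kbar tw) : R :=
  if x == 0 then 0
  else if x \notin Ssub 1 then 1
  else (Sindex (xget 0%N
         [set n | (0 < n)%N /\ (Ssub n `\` Ssub n.+1) x]))%:R^-1.

Definition Sdist (x y : Kbar tw) : R := Sabs (x - y).

End GroupS.

Arguments S0 {R K} tw.
Arguments Ssub {R K} tw n.
Arguments Sdist {R K} tw x y.

Section Process.
Variables (R : realType) (K : fieldType) (tw : tower R K).

Definition is_rank0_character (chi : K -> R[i]) : Prop :=
  let k := tK tw 0 in let abs := tabs tw 0 in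
  [/\ forall x y, x \in k -> y \in k -> chi (x + y) = chi x * chi y,
      forall x, x \in k -> `|chi x| = 1,
      forall x (e : R), x \in k -> 0 < e -> exists2 c : R, 0 < c &
        forall y, y \in k -> abs (y - x) < c -> `|chi y - chi x| < e%:C%C,
      forall x, x \in k -> abs x <= 1 -> chi x = 1
    & exists x, [/\ x \in k, abs x <= (tq tw 0)%:R & chi x != 1]].

Definition cintegral (mu : probability (Kbar tw) R) (f : Kbar tw -> R[i]) :
    R[i] :=
  Complex (\int[mu]_x complex.Re (f x)) (\int[mu]_x complex.Im (f x)).

Definition is_radon (mu : probability (Kbar tw) R) : Prop :=
  forall A : set (Kbar tw), measurable A ->
    mu A = ereal_sup [set mu C | C in [set C | compact C /\ C `<=` A]].

Record is_stable_semigroup (chi : K -> R[i]) (alpha : R)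
    (mu : R -> probability (Kbar tw) R) : Prop := IsStableSemigroup {
  ss_radon : forall t : R, 0 < t -> is_radon (mu t);
  ss_convolution : forall s t : R, 0 < s -> 0 < t ->
    forall A : set (Kbar tw), measurable A ->
      mu (s + t) A = (mu s \x mu t)%E [set xy | A (xy.1 + xy.2)];
  ss_concentrated : forall t : R, 0 < t -> mu t (~` S0 tw) = 0%E;
  ss_fourier : forall t : R, 0 < t -> forall i xi, xi \in tK tw i ->
    cintegral (mu t) (fun x => chi (pairing i xi x)) =
    (if 1 < tnorm tw xi then expR (- t * tnorm tw xi `^ alpha) else 1)%:C%C
}.

Record is_levy_process d (Omega : measurableType d) (P : probability Omega R)
    (X : R -> Omega -> Kbar tw) : Prop := IsLevyProcess {
  lp_measurable : forall t : R, 0 <= t -> measurable_fun setT (X t);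
  lp_values : forall (t : R) w, 0 <= t -> S0 tw (X t w);
  lp_start : {ae P, forall w, X 0 w = 0};
  lp_independent : forall n (t : nat -> R) (A : nat -> set (Kbar tw)),
    0 <= t 0%N -> (forall i, t i <= t i.+1) ->
    (forall i, measurable (A i)) ->
    fine (P [set w | forall i, (i < n)%N -> A i (X (t i.+1) w - X (t i) w)]) =
    \prod_(i < n) fine (P [set w | A i (X (t i.+1) w - X (t i) w)]);
  lp_stationary : forall s t : R, 0 <= s -> 0 <= t ->
    forall A : set (Kbar tw), measurable A ->
      P [set w | A (X (s + t) w - X s w)] = P [set w | A (X t w - X 0 w)];
  lp_cadlag : {ae P, forall w,
    (forall t : R, 0 <= t -> X s w @[s --> t^'+] --> X t w) /\
    (forall t : R, 0 < t ->
       exists2 l, S0 tw l & X s w @[s --> t^'-] --> l)}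
}.

End Process.

(* Dimensions of subsets of a metric space with underlying set [X] and metric
   [dist]. Only exponents [s > 0] are used, which does not change the infima
   and makes empty and one-point sets of the covers contribute 0. *)
Section Dimensions.
Variables (R : realType) (T : Type) (X : set T) (dist : T -> T -> R).
Implicit Types A : set T.

Local Open Scope ereal_scope.

(* For bounded [U]. *)
Definition diameter (U : set T) : R :=
  sup [set dist xy.1 xy.2 | xy in U `*` U].

Definition hausdorff_pre (s delta : R) A : \bar R :=
  ereal_inf [set \sum_(0 <= i <oo) (diameter (U i) `^ s)%:E
    | U in [set U : nat -> set T |
        [/\ forall i, U i `<=` X, A `<=` \bigcup_i U i
          & forall i, (diameter (U i) <= delta)%R]]].

Definition hausdorff_measure (s : R) A : \bar R :=
  ereal_sup [set hausdorff_pre s delta A | delta in [set delta | (0 < delta)%R]].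

Definition hausdorff_dim A : \bar R :=
  ereal_inf [set s%:E | s in [set s | (0 < s)%R /\ hausdorff_measure s A = 0]].

Definition closed_ball_in (x : T) (r : R) : set T :=
  [set y | X y /\ (dist x y <= r)%R].

(* A packing is an at most countable family, indexed by [I : set nat], of
   pairwise disjoint closed balls centered in [A]. *)
Definition is_packing (delta : R) A (I : set nat) (x : nat -> T)
    (r : nat -> R) : Prop :=
  [/\ forall i, I i -> A (x i),
      forall i, I i -> (0 < r i <= delta)%R
    & trivIset I (fun i => closed_ball_in (x i) (r i))].

Definition packing_pre_delta (s delta : R) A : \bar R :=
  ereal_sup [set p | exists I x r, is_packing delta A I x r /\
    p = \esum_(i in I) ((2 * r i) `^ s)%:E].

Definition packing_pre (s : R) A : \bar R :=
  ereal_inf [set packing_pre_delta s delta A | delta in [set delta | (0 < delta)%R]].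

Definition packing_measure (s : R) A : \bar R :=
  ereal_inf [set \sum_(0 <= i <oo) packing_pre s (U i)
    | U in [set U : nat -> set T |
        (forall i, U i `<=` X) /\ A `<=` \bigcup_i U i]].

Definition packing_dim A : \bar R :=
  ereal_inf [set s%:E | s in [set s | (0 < s)%R /\ packing_measure s A = 0]].

End Dimensions.

(* Main.v *)
(* The characters of S that are trivial on S_n are given by the xi in K_n with
   ||xi|| <= q_1^n, taken modulo the integers of K_n. There are q_1^(n m_n) of
   them, so that S / S_n has this order as well. Averaging the Fourier transform
   over these xi gives P(X_S(h) notin S_n) <= h q_1^(n alpha). Hence the path on
   [0, t], seen modulo S_n, makes at most t q_1^(n alpha) jumps on average, and
   almost surely X_S([0, t]) meets at most C (2 q_1^alpha)^n cosets of S_n for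
   all n. Balls of S are cosets of the S_n, and S_n has diameter at most
   q_1^(-n m_n) with m_n >= n, which decays faster than any power of this
   number of cosets grows; so both dimensions vanish. *)
Require Import Defs.
From HB Require Import structures.
From mathcomp Require Import all_boot all_order all_algebra.
From mathcomp Require Import zify ring.
From mathcomp Require Import finmap complex.
From mathcomp Require Import all_classical all_reals all_analysis.
From mathcomp Require Import measurable_realfun.

Set Implicit Arguments.
Unset Strict Implicit.
Unset Printing Implicit Defensive.

Import Order.TTheory GRing.Theory Num.Theory.
Import numFieldTopology.Exports numFieldNormedType.Exports.

Local Open Scope classical_set_scope.
Local Open Scope ring_scope.

(** * Trace forms in towers of fields *)

(** Dividing the coordinate x_i by m_i makes the sequence compatible with plain traces, so that S
    and the S_n become trace duals of fractional ideals. Duality is then needed in both directions.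
    That a point outside S_n is detected by some xi comes from the maximality of the different
    exponent. That every xi of norm above 1 is nontrivial on S is read off the given semigroup,
    whose Fourier transform at time 1 is less than 1 there; this takes the place of surjectivity of
    the coordinate maps. The 2 in 2 q_1^alpha pays for treating all n at once: jumps at level n get
    weights that decay like 2^-n relative to their expected number, so the weighted total has
    expectation at most 2t. Jumps are counted on dyadic grids, with the same bound for every grid.
    Fatou's lemma then gives one constant valid for infinitely many grids, which is enough: by right
    continuity, a finite family of inequivalent points of the range can be moved to grid points, and
    the grids are nested. *)

Section Subfields.
Variables (K : fieldType) (F : {pred K}).
Hypothesis hF : GRing.divring_closed F.

Lemma subfield1 : 1 \in F. Proof. by case: hF. Qed.

Lemma subfieldB x y : x \in F -> y \in F -> x - y \in F.
Proof. by case: hF => _ h _; exact: h. Qed.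

Lemma subfield0 : 0 \in F. Proof. by rewrite -(subrr 1) subfieldB// subfield1. Qed.

Lemma subfieldN x : x \in F -> - x \in F.
Proof. by move=> hx; rewrite -sub0r subfieldB// subfield0. Qed.

Lemma subfieldD x y : x \in F -> y \in F -> x + y \in F.
Proof. by move=> hx hy; rewrite -[y]opprK subfieldB// subfieldN. Qed.

Lemma subfieldV x : x \in F -> x^-1 \in F.
Proof. by move=> hx; rewrite -[_^-1]mul1r; case: hF => h1 _; exact. Qed.

Lemma subfieldM x y : x \in F -> y \in F -> x * y \in F.
Proof.
by move=> hx hy; rewrite -[y]invrK; case: hF => _ _; apply => //; exact: subfieldV.
Qed.

Lemma subfield_sum (I : Type) (r : seq I) (p : pred I) (f : I -> K) :
  (forall i, p i -> f i \in F) -> \sum_(i <- r | p i) f i \in F.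
Proof.
move=> hf; apply: (big_ind (fun y => y \in F)) => //; first exact: subfield0.
exact: subfieldD.
Qed.

Lemma subfield_nat n : n%:R \in F.
Proof.
elim: n => [|n ih]; first exact: subfield0.
by rewrite -addn1 natrD subfieldD// subfield1.
Qed.

Lemma subfieldX x n : x \in F -> x ^+ n \in F.
Proof.
move=> hx; elim: n => [|n ih]; first by rewrite expr0 subfield1.
by rewrite exprS subfieldM.
Qed.

Lemma subfieldXz x (z : int) : x \in F -> x ^ z \in F.
Proof.
by move=> hx; case: z => n; rewrite ?NegzE -?exprnN ?subfieldV// subfieldX.
Qed.

End Subfields.

Section TraceTower.
Variables (K : fieldType) (F E L : {pred K}).
Hypotheses (hF : GRing.divring_closed F) (hE : GRing.divring_closed E)
  (hL : GRing.divring_closed L).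
Hypotheses (FE : {subset F <= E}) (EL : {subset E <= L}).

Lemma ext_trace_in x : ext_trace F E x \in F.
Proof.
rewrite /ext_trace; case: xgetP => [t _ [d [b [A [_ hA _ ->]]]]|_].
  exact: subfield_sum.
exact: subfield0.
Qed.

Lemma ext_traceZ a x : a \in F -> x \in E ->
  ext_trace F E (a * x) = a * ext_trace F E x.
Proof.
move=> aF xE.
have [[d [b hb]]|nb] := pselect (exists d (b : 'I_d -> K), is_basis F E b).
  have [d' [b' [A [hb' hA xA tA]]]] := is_trace_ext hF hE hb xE.
  apply: ext_traceP => //; exists d', b', (a *: A); split => //.
  - by move=> i j; rewrite mxE subfieldM.
  - move=> i; rewrite -mulrA xA mulr_sumr.
    by apply: eq_bigr => j _; rewrite mxE mulrA.
  - by rewrite mxtraceZ -tA.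
have tr0 z : ext_trace F E z = 0.
  rewrite /ext_trace; case: xgetP => // t _ [d [b [A [hb _ _ _]]]].
  by case: nb; exists d, b.
by rewrite !tr0 mulr0.
Qed.

(* A spanning family of minimal size is a basis. *)
Lemma is_basis_exists d (b : 'I_d -> K) :
  is_basis F L b -> exists e (c : 'I_e -> K), is_basis E L c.
Proof.
move=> [bL _ bspan].
pose spans n (c : 'I_n -> K) := (forall i, c i \in L) /\
  forall x, x \in L ->
    exists2 a : 'I_n -> K, forall i, a i \in E & x = \sum_i a i * c i.
have ex : exists n, `[< exists c : 'I_n -> K, spans n c >].
  exists d; apply/asboolP; exists b; split=> // x /bspan[a aF ->].
  by exists a => // i; exact: FE.
case: (ex_minnP ex) => e /asboolP[c [cL cspan]] emin.
exists e, c; split => // a aE a0 i; apply/eqP/negPn/negP => ai0.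
case: e c cL cspan emin a aE a0 i ai0 => [|e] c cL cspan emin a aE a0 i ai0.
  by case: i {ai0}.
suff /emin : `[< exists c : 'I_e -> K, spans e c >] by rewrite ltnn.
apply/asboolP; exists (c \o lift i); split=> [j|x /cspan[u uE ->]]; first exact: cL.
exists (fun j => u (lift i j) - u i * (a (lift i j) / a i)) => [j|].
  by rewrite subfieldB// subfieldM// subfieldM// subfieldV.
have D1 (f : 'I_e.+1 -> K) : \sum_j f j = f i + \sum_j f (lift i j).
  exact: (@bigD1_ord _ +%R 0 _ i xpredT).
move: a0; rewrite (D1 (fun i => a i * c i)) (D1 (fun i => u i * c i)) => a0.
have -> : c i = - \sum_j a (lift i j) / a i * c (lift i j).
  apply: (mulfI ai0); apply/eqP; rewrite mulrN -addr_eq0 mulr_sumr -[X in _ == X]a0.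
  apply/eqP; congr +%R; apply: eq_bigr => j _.
  by rewrite mulrA [X in X * _]mulrC divfK.
rewrite mulrN mulr_sumr addrC -sumrB; apply: eq_bigr => j _.
by rewrite /= mulrBl -!mulrA.
Qed.

(** A basis is indexed by an ordinal, so a product basis needs a bijection of ['I_(d * e)] with
    pairs; the numbering of matrix entries provides one. *)
Let unpair d e (k : 'I_(d * e)) : 'I_d * 'I_e :=
  enum_val (cast_ord (esym (mxvec_cast d e)) k).

Let unpairE d e (i : 'I_d) (j : 'I_e) : unpair (mxvec_index i j) = (i, j).
Proof. by rewrite /unpair /mxvec_index cast_ordK enum_rankK. Qed.

Let sum_pair d e (f : 'I_(d * e) -> K) :
  \sum_k f k = \sum_i \sum_j f (mxvec_index i j).
Proof.
rewrite (reindex _ (curry_mxvec_bij d e)) pair_bigA /=.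
by apply: eq_bigr => -[].
Qed.

Let prod_basis d (b : 'I_d -> K) e (c : 'I_e -> K) (k : 'I_(d * e)) : K :=
  b (unpair k).1 * c (unpair k).2.

Lemma is_basis_mul d (b : 'I_d -> K) e (c : 'I_e -> K) :
  is_basis F E b -> is_basis E L c -> is_basis F L (prod_basis b c).
Proof.
move=> [bE bfree bspan] [cL cfree cspan]; split.
- by move=> k; rewrite /prod_basis subfieldM//; exact: EL.
- move=> a aF; rewrite sum_pair exchange_big /= => a0 k.
  case/mxvec_indexP: k => i j.
  apply: (bfree (fun i => a (mxvec_index i j))) => //.
  apply: (cfree (fun j => \sum_i a (mxvec_index i j) * b i)) => [j'|].
    by apply: subfield_sum => // i' _; rewrite subfieldM//; exact: FE.
  rewrite -[RHS]a0; apply: eq_bigr => j' _; rewrite mulr_suml.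
  by apply: eq_bigr => i' _; rewrite /prod_basis unpairE mulrA.
- move=> x /cspan[a aE ->].
  have /choice[u hu] : forall j, exists u : 'I_d -> K,
      (forall i, u i \in F) /\ a j = \sum_i u i * b i.
    by move=> j; have [u] := bspan _ (aE j); exists u.
  exists (fun k => u (unpair k).2 (unpair k).1) => [k|]; first exact: (hu _).1.
  rewrite sum_pair exchange_big /=; apply: eq_bigr => j _.
  rewrite (hu j).2 mulr_suml; apply: eq_bigr => i _.
  by rewrite /prod_basis unpairE mulrA.
Qed.

(** In the product basis, multiplication by [x] is a block matrix: each entry of its matrix over [E]
    is replaced by the matrix over [F] of multiplication by that entry. Only the diagonal blocks
    contribute to the trace. *)
Lemma ext_trace_trans d (b : 'I_d -> K) e (c : 'I_e -> K) x :
  is_basis F E b -> is_basis E L c -> x \in L ->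
  ext_trace F L x = ext_trace F E (ext_trace E L x).
Proof.
move=> hb hc xL; have [bE _ bspan] := hb; have [cL _ cspan] := hc.
have [A hA xA] : exists2 A : 'I_e -> 'I_e -> K, forall j j', A j j' \in E &
    forall j, x * c j = \sum_j' A j j' * c j'.
  have /choice[A hA] : forall j, exists a : 'I_e -> K,
      (forall j', a j' \in E) /\ x * c j = \sum_j' a j' * c j'.
    by move=> j; have [|a] := cspan (x * c j); [exact: subfieldM|exists a].
  by exists A => j; case: (hA j).
have [B hB AB] : exists2 B : 'I_e -> 'I_e -> 'M[K]_d,
    forall j j' i i', B j j' i i' \in F &
    forall j j' i, A j j' * b i = \sum_i' B j j' i i' * b i'.
  have /choice[B hB] : forall p : 'I_e * 'I_e * 'I_d, exists a : 'I_d -> K,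
      (forall i', a i' \in F) /\ A p.1.1 p.1.2 * b p.2 = \sum_i' a i' * b i'.
    move=> p; have [|a] := bspan (A p.1.1 p.1.2 * b p.2); last by exists a.
    exact: subfieldM.
  exists (fun j j' => \matrix_(i, i') B (j, j', i) i') => [j j' i i'|j j' i].
    by rewrite mxE; exact: (hB (j, j', i)).1.
  rewrite (hB (j, j', i)).2; by apply: eq_bigr => i' _; rewrite mxE.
have trE : ext_trace E L x = \sum_j A j j.
  apply: ext_traceP => //; exists e, c, (\matrix_(j, j') A j j'); split => //.
  - by move=> j j'; rewrite mxE.
  - by move=> j; rewrite xA; apply: eq_bigr => j' _; rewrite mxE.
  - by apply: eq_bigr => j' _; rewrite mxE.
rewrite trE; have -> : ext_trace F E (\sum_j A j j) = \sum_j \tr (B j j).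
  apply: ext_traceP => //; exists d, b, (\sum_j B j j); split => //.
  - by move=> i i'; rewrite summxE; exact: subfield_sum.
  - move=> i; rewrite mulr_suml; under eq_bigr do rewrite AB.
    rewrite exchange_big; apply: eq_bigr => i' _.
    by rewrite summxE mulr_suml.
  - by rewrite raddf_sum.
apply: ext_traceP => //; exists (d * e)%N, (prod_basis b c), (\matrix_(k, k')
  B (unpair k).2 (unpair k').2 (unpair k).1 (unpair k').1).
split; first exact: is_basis_mul hb hc.
- by move=> k k'; rewrite mxE.
- move=> k; case/mxvec_indexP: k => i j; rewrite /prod_basis unpairE/=.
  rewrite mulrCA xA mulr_sumr sum_pair exchange_big /=; apply: eq_bigr => j' _.
  rewrite mulrA [b i * _]mulrC AB mulr_suml; apply: eq_bigr => i' _.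
  by rewrite mxE !unpairE/= mulrA.
- rewrite /mxtrace sum_pair exchange_big /=; apply: eq_bigr => j _.
  by apply: eq_bigr => i _; rewrite mxE !unpairE.
Qed.

Lemma is_trace1 d (b : 'I_d -> K) : is_basis F E b -> is_trace F E 1 d%:R.
Proof.
move=> hb; exists d, b, 1%:M; split => //.
- by move=> i j; rewrite mxE; case: eqP; rewrite ?subfield0 ?subfield1.
- move=> i; rewrite mul1r (bigD1 i)//= mxE eqxx mul1r big1 ?addr0// => j ji.
  by rewrite mxE eq_sym (negPf ji) mul0r.
- by rewrite mxtrace_scalar.
Qed.

(** The trace of 1 is the size of any basis, as an element of [K]; characteristic zero recovers the
    integer from it. *)
Lemma is_basis_size d (b : 'I_d -> K) e (c : 'I_e -> K) :
  [pchar K] =i pred0 -> is_basis F E b -> is_basis F E c -> d = e.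
Proof.
move=> /pcharf0P char0 /is_trace1 hb /is_trace1 hc.
have := is_trace_uniq hF hb hc; wlog de : d e {b c hb hc} / (d <= e)%N => [h|].
  by have [/h//|/ltnW/h h' /esym/h'] := leqP d e.
move=> /eqP; rewrite eq_sym -subr_eq0 -natrB// char0 subn_eq0 => ed.
by apply/eqP; rewrite eqn_leq de.
Qed.

End TraceTower.

Lemma is_basis_self (K : fieldType) (E : {pred K}) :
  GRing.divring_closed E -> is_basis E E (fun _ : 'I_1 => 1).
Proof.
move=> hE; split.
- by move=> _; exact: subfield1.
- by move=> a aE; rewrite big_ord1 mulr1 => a0 i; rewrite (ord1 i).
- by move=> x xE; exists (fun=> x) => //; rewrite big_ord1 mulr1.
Qed.

(** * Coset representatives and character sums *)

Section Transversals.
Variable V : zmodType.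
Implicit Types (A B C : set V) (I J : finType).

Definition is_subgroup A := A 0 /\ forall x y, A x -> A y -> A (x - y).

(** Finiteness of the quotient is carried by the index type, and sums over the quotient become sums
    over [I], without forming cosets. *)
Definition coset_reps A B I (r : I -> V) :=
  [/\ forall i, A (r i), forall x, A x -> exists i, B (x - r i)
    & forall i j, B (r i - r j) -> i = j].

Lemma subgroupN A x : is_subgroup A -> A x -> A (- x).
Proof. by move=> [A0 AB] Ax; rewrite -sub0r; exact: AB. Qed.

Lemma subgroupD A x y : is_subgroup A -> A x -> A y -> A (x + y).
Proof.
by move=> hA Ax Ay; rewrite -[y]opprK; apply: hA.2 => //; exact: subgroupN.
Qed.

Lemma coset_eq B x y : is_subgroup B ->
  [set x + z | z in B] = [set y + z | z in B] <-> B (x - y).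
Proof.
move=> hB; split=> [/seteqP[/(_ x) h _]|Bxy].
  have [|z Bz <-] := h; first by exists 0; rewrite ?addr0//; case: hB.
  by rewrite addrC addKr.
apply/seteqP; split=> _ [z Bz <-].
  exists (x - y + z); first exact: subgroupD.
  by rewrite addrA [y + _]addrC subrK.
exists (z - (x - y)); first exact: hB.2.
by rewrite opprB addrCA [x + _]addrC subrK addrC.
Qed.

Lemma coset_reps_index A B I (r : I -> V) : is_subgroup B ->
  coset_reps A B r -> finite_set (cosets A B) /\ coset_index A B = #|I|.
Proof.
move=> hB [rA rAB rinj].
pose c i : set V := [set r i + y | y in B].
have cE : cosets A B = [set` [fset c i | i in I]%fset].
  apply/seteqP; split=> u /=.
    move=> [x Ax <-]; have [i Bxi] := rAB _ Ax.
    by apply/imfsetP; exists i => //=; apply/coset_eq.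
  by move=> /imfsetP[i _ ->]; exists (r i).
rewrite /coset_index cE set_fsetK card_imfset/=; first by rewrite -cardE.
by move=> i j /coset_eq => /(_ hB) /rinj.
Qed.

Lemma coset_reps_exists A B : is_subgroup B -> finite_set (cosets A B) ->
  exists I (r : I -> V), coset_reps A B r.
Proof.
move=> hB fin; set X := fset_set (cosets A B).
have /choice[r hr] (i : X) : exists x, A x /\ [set x + y | y in B] = fsval i.
  have : fsval i \in X by exact: fsvalP.
  by rewrite in_fset_set// inE => -[x Ax <-]; exists x.
exists X, r; split=> [i|x Ax|i j]; first exact: (hr i).1.
  have xX : [set x + y | y in B] \in X.
    by rewrite in_fset_set// inE; exists x.
  by exists [` xX]%fset; apply/coset_eq => //; rewrite (hr _).2.
by move=> /coset_eq => /(_ hB); rewrite !(hr _).2 => /val_inj.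
Qed.

(** [g] has finitely many values and separates the cosets, so one chosen point per value already
    reaches all of them. *)
Lemma coset_reps_exists_fin A B J (g : V -> J) : is_subgroup B ->
  (forall x y, A x -> A y -> g x = g y -> B (x - y)) ->
  exists I (r : I -> V), coset_reps A B r.
Proof.
move=> hB gB; apply: coset_reps_exists => //.
have /choice[h hh] j : exists x, (exists2 y, A y & g y = j) -> A x /\ g x = j.
  have [[y Ay gy]|n] := pselect (exists2 y, A y & g y = j); first by exists y.
  by exists 0.
apply: (@sub_finite_set _ _ [set [set h j + y | y in B] | j in [set: J]]).
  move=> _ [x Ax <-]; exists (g x) => //; apply/coset_eq => //.
  by have [Ahx gx] := hh (g x) (ex_intro2 _ _ x Ax erefl); exact: gB.
exact/finite_image/finite_finset.
Qed.

Lemma coset_reps_mul A B C I J (r : I -> V) (s : J -> V) :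
  is_subgroup A -> is_subgroup B -> is_subgroup C -> B `<=` A -> C `<=` B ->
  coset_reps A B r -> coset_reps B C s ->
  coset_reps A C (fun p : I * J => r p.1 + s p.2).
Proof.
move=> hA hB hC BA CB [rA rAB rinj] [sB sBC sinj]; split=> [[i j]|x Ax|].
- by apply: subgroupD => //; exact: BA.
- have [i /sBC[j]] := rAB _ Ax; rewrite -addrA -opprD => Cx.
  by exists (i, j).
- move=> [i j] [i' j'] /= Cx.
  have ii' : i = i'.
    apply: rinj; have -> : r i - r i' = (r i + s j - (r i' + s j')) + (s j' - s j).
      by rewrite opprD [X in X + (_ - _)]addrACA -[RHS]addrA subrKA subrr addr0.
    by apply: subgroupD => //; [exact: CB|exact: hB.2].
  rewrite ii'; congr pair; apply: sinj.
  by move: Cx; rewrite ii' opprD addrACA subrr add0r.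
Qed.

Lemma coset_reps_unique A B I (r : I -> V) :
  is_subgroup A -> is_subgroup B -> coset_reps A B r ->
  exists i0, forall i, B (r i) <-> i = i0.
Proof.
move=> hA hB [rA rAB rinj]; have [i0 B0] := rAB _ hA.1.
move: B0; rewrite sub0r => /(subgroupN hB); rewrite opprK => B0.
exists i0 => i; split=> [Bi|->//]; apply: rinj; exact: hB.2.
Qed.

Lemma coset_reps_refl A : is_subgroup A -> coset_reps A A (fun _ : unit => 0).
Proof.
move=> [A0 _]; split=> // [x Ax|[] []//].
by exists tt; rewrite subr0.
Qed.

(** Translation by [a] permutes the cosets (the map [s]), so the sum equals [phi a] times itself. *)
Lemma sum_character A B I (r : I -> V) (C : idomainType) (phi : V -> C) a :
  is_subgroup A -> is_subgroup B -> coset_reps A B r ->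
  (forall x y, A x -> A y -> phi (x + y) = phi x * phi y) ->
  (forall x, B x -> A x -> phi x = 1) -> A a -> phi a != 1 ->
  \sum_i phi (r i) = 0.
Proof.
move=> hA hB [rA rAB rinj] phiD phiB Aa phia.
have /choice[s hs] i : exists j, B (a + r i - r j).
  by apply: rAB; exact: subgroupD.
have sE i : phi a * phi (r i) = phi (r (s i)).
  rewrite -phiD// -[a + r i](subrK (r (s i))) phiD//.
  - by rewrite phiB ?mul1r//; apply: hA.2 => //; exact: subgroupD.
  - by apply: hA.2 => //; exact: subgroupD.
have sinj : injective s.
  move=> i j sij; apply: rinj.
  have -> : r i - r j = (a + r i - r (s i)) - (a + r j - r (s j)).
    by rewrite -sij opprB addrA subrK opprD addrACA subrr add0r.
  exact: hB.2.
apply/eqP; have : phi a * (\sum_i phi (r i)) = \sum_i phi (r i).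
  rewrite mulr_sumr; under eq_bigr do rewrite sE.
  by rewrite [RHS](reindex_inj sinj).
move=> /eqP; rewrite -subr_eq0 -[X in _ - X]mul1r -mulrBl mulf_eq0 subr_eq0.
by rewrite (negPf phia).
Qed.

End Transversals.

(** * Fractional ideals of a local field *)

Section LocalField.
Variables (R : realType) (K : fieldType) (F : {pred K}) (abs : K -> R).
Hypothesis lF : is_local_field F abs.

Let hF := lf_subfield lF.
Let q := residue_card F abs.

Lemma abs0 : abs 0 = 0.
Proof. by apply/(lf_abs_eq0 lF) => //; exact: subfield0. Qed.

Lemma abs_neq0 x : x \in F -> x != 0 -> abs x != 0.
Proof. by move=> xF; apply: contra_neq => /(lf_abs_eq0 lF) ->. Qed.

Lemma abs1 : abs 1 = 1.
Proof.
apply: (mulfI (abs_neq0 (subfield1 hF) (oner_neq0 K))).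
by rewrite -(lf_absM lF) ?mulr1// (subfield1 hF).
Qed.

Lemma absN x : x \in F -> abs (- x) = abs x.
Proof.
move=> xF; have N1 := subfieldN hF (subfield1 hF).
rewrite -mulN1r (lf_absM lF)//.
have /eqP : abs (-1) ^+ 2 = 1 by rewrite -[RHS]abs1 expr2 -(lf_absM lF)// mulrNN mulr1.
by rewrite sqrp_eq1 ?(lf_abs_ge0 lF)// => /eqP ->; rewrite mul1r.
Qed.

Lemma absB x y : x \in F -> y \in F -> abs (x - y) <= Num.max (abs x) (abs y).
Proof. by move=> xF yF; rewrite -(absN yF) (lf_absD lF)// subfieldN. Qed.

Lemma absV x : x \in F -> abs x^-1 = (abs x)^-1.
Proof.
move=> xF; have [->|x0] := eqVneq x 0; first by rewrite invr0 abs0 invr0.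
apply: (mulfI (abs_neq0 xF x0)).
by rewrite -(lf_absM lF) ?subfieldV// divff// abs1 divff// abs_neq0.
Qed.

Lemma absX x n : x \in F -> abs (x ^+ n) = abs x ^+ n.
Proof.
move=> xF; elim: n => [|n ih]; first by rewrite abs1.
by rewrite !exprS (lf_absM lF) ?subfieldX// ih.
Qed.

Lemma absXz x (z : int) : x \in F -> abs (x ^ z) = abs x ^ z.
Proof.
move=> xF; case: z => n; first exact: absX.
by rewrite NegzE -!exprnN absV ?absX// subfieldX.
Qed.

Lemma valuation_ring_subgroup : is_subgroup (valuation_ring F abs).
Proof.
split=> [|x y [xF x1] [yF y1]]; first by split; rewrite ?subfield0 ?abs0.
by split; [exact: subfieldB|rewrite (le_trans (absB _ _))// ge_max x1].
Qed.

Lemma valuation_ideal_subgroup : is_subgroup (valuation_ideal F abs).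
Proof.
split=> [|x y [xF x1] [yF y1]]; first by split; rewrite ?subfield0 ?abs0.
by split; [exact: subfieldB|rewrite (le_lt_trans (absB _ _))// gt_max x1].
Qed.

Lemma valuation_idealM x y : valuation_ideal F abs x -> valuation_ring F abs y ->
  valuation_ideal F abs (x * y).
Proof.
move=> [xF x1] [yF y1]; split; first exact: subfieldM.
rewrite (lf_absM lF)// (le_lt_trans _ x1)// ler_piMr//.
exact: (lf_abs_ge0 lF).
Qed.

Lemma residue_coset_reps : exists (I : finType) (r : I -> K),
  coset_reps (valuation_ring F abs) (valuation_ideal F abs) r /\ #|I| = q.
Proof.
have [I [r hr]] := coset_reps_exists valuation_ideal_subgroup
  (lf_residue_finite lF).
exists I, r; split=> //.
by have [_] := coset_reps_index valuation_ideal_subgroup hr.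
Qed.

Lemma residue_card_gt1 : (1 < q)%N.
Proof.
have [I [r [[rO rOm rinj] <-]]] := residue_coset_reps.
have [|i hi] := rOm 0; first by case: valuation_ring_subgroup.
have [|j hj] := rOm 1; first by split; rewrite ?abs1// subfield1.
rewrite ltnNge; apply/negP => /card_le1_eqP/(_ i j isT isT) ij.
have := valuation_ideal_subgroup.2 _ _ hj hi.
by rewrite ij sub0r opprK subrK => -[_]; rewrite abs1 ltxx.
Qed.

Let q1 : 1 < q%:R :> R. Proof. by rewrite ltr1n residue_card_gt1. Qed.
Let q0 : 0 < q%:R :> R. Proof. exact: lt_trans q1. Qed.

Definition frac_ideal (c : int) : set K := [set x | x \in F /\ abs x <= q%:R ^ c].

Lemma frac_ideal_subgroup c : is_subgroup (frac_ideal c).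
Proof.
split=> [|x y [xF x1] [yF y1]].
  by split; rewrite ?subfield0 ?abs0// ltW// exprz_gt0.
by split; [exact: subfieldB|rewrite (le_trans (absB _ _))// ge_max x1].
Qed.

Lemma sub_frac_ideal c c' : c <= c' -> frac_ideal c `<=` frac_ideal c'.
Proof.
by move=> cc' x [xF x1]; split=> //; rewrite (le_trans x1)// ler_eXz2l.
Qed.

(** Nonzero values are integral powers of [q], so a strict bound lowers the exponent by one. *)
Lemma abs_lt_frac_ideal x c : x \in F -> abs x < q%:R ^ c -> frac_ideal (c - 1) x.
Proof.
move=> xF; have [->|x0] := eqVneq x 0.
  by move=> _; have [] := frac_ideal_subgroup (c - 1).
move=> h; split=> //; move: h; have [z ->] := lf_value_group lF xF x0.
by rewrite ltr_eXz2l// ler_eXz2l// => zc; rewrite lerBrDr lezD1.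
Qed.

Lemma frac_ideal_coset_reps1 c : exists (I : finType) (r : I -> K),
  coset_reps (frac_ideal (c + 1)) (frac_ideal c) r /\ #|I| = q.
Proof.
have [I [r [[rO rOm rinj] cI]]] := residue_coset_reps.
have [p pF absp] := lf_uniformizer lF.
have p0 : p != 0.
  by apply/eqP => p0; move: absp; rewrite p0 abs0 => /esym/eqP; rewrite invr_eq0 gt_eqF.
have absu z : abs (p ^ z) = q%:R ^ (- z) by rewrite absXz// absp exprz_inv.
have pzF z : p ^ z \in F by exact: subfieldXz.
have pz0 z : p ^ z != 0 by rewrite expfz_neq0.
have sc x : x \in F -> p ^ (c + 1) * x \in F by move=> xF; exact: subfieldM.
have q_neq0 : q%:R != 0 :> R by rewrite gt_eqF.
(* Multiplication by [p ^ (c + 1)] carries the two fractional ideals to the ring of integers and its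
   maximal ideal, so residue representatives are scaled back. *)
exists I, (fun i => p ^ (- (c + 1)) * r i); split=> //; split=> [i|x [xF x1]|i j].
- have [rF r1] := rO i; split; first exact: subfieldM.
  by rewrite (lf_absM lF)// absu opprK ler_piMr// ltW// exprz_gt0.
- have [|i [iF i1]] := rOm (p ^ (c + 1) * x).
    split; first exact: sc.
    rewrite (lf_absM lF)// absu -(@ler_pM2l _ (q%:R ^ (c + 1))) ?exprz_gt0//.
    by rewrite mulrA -expfzDr// subrr mul1r mulr1.
  exists i; have -> : x - p ^ (- (c + 1)) * r i =
      p ^ (- (c + 1)) * (p ^ (c + 1) * x - r i).
    by rewrite mulrBr mulrA -expfzDr// addNr mul1r.
  rewrite -[X in frac_ideal X](addrK 1 c).
  apply: abs_lt_frac_ideal; first exact: subfieldM.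
  by rewrite (lf_absM lF)// absu opprK gtr_pMr// exprz_gt0.
- have [iF _] := rO i; have [jF _] := rO j.
  rewrite -mulrBr => -[_]; rewrite (lf_absM lF) ?subfieldB// absu opprK => h.
  apply: rinj; split; first exact: subfieldB.
  move: h; rewrite expfzDr// -mulrA ger_pMr ?exprz_gt0//.
  rewrite -ler_pdivlMl ?expr1z// mulr1 => /le_lt_trans; apply.
  by rewrite invf_lt1.
Qed.

Lemma frac_ideal_coset_reps c (a : nat) : exists (I : finType) (r : I -> K),
  coset_reps (frac_ideal (c + a%:Z)) (frac_ideal c) r /\ #|I| = (q ^ a)%N.
Proof.
elim: a => [|a [I [r [hr cI]]]].
  exists unit, (fun=> 0); rewrite addr0 card_unit; split=> //.
  exact/coset_reps_refl/frac_ideal_subgroup.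
have [J [s [hs cJ]]] := frac_ideal_coset_reps1 (c + a%:Z).
exists (J * I)%type, (fun p => s p.1 + r p.2).
rewrite card_prod cI cJ expnS; split=> //.
apply: (@coset_reps_mul _ _ (frac_ideal (c + a%:Z))) => //;
  try exact: frac_ideal_subgroup.
- by apply: sub_frac_ideal; rewrite lerD2l lez_nat.
- by apply: sub_frac_ideal; rewrite lerDl.
- by rewrite -addn1 PoszD addrA.
Qed.

End LocalField.

(** * Residue degree and cardinality of the residue field *)

Section ResidueDegree.
Variables (R : realType) (K : fieldType) (F E : {pred K}) (absF absE : K -> R).
Hypotheses (lF : is_local_field F absF) (lE : is_local_field E absE).
Hypotheses (ringFE : valuation_ring F absE = valuation_ring F absF)
  (idealFE : valuation_ideal F absE = valuation_ideal F absF)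
  (FE : {subset F <= E}).

(** The combinations [s g], with residue representatives of [F] as coefficients, meet each residue
    class of [E] once. The two absolute values are normalized differently on [F], but they define
    the same ring and the same ideal there. *)
Lemma residue_basis_card f (b : 'I_f -> K) : is_residue_basis F E absE b ->
  residue_card E absE = (residue_card F absF ^ f)%N.
Proof.
move=> [bO bfree bspan].
have [I [r [[rO rOm rinj] <-]]] := residue_coset_reps lF.
have [ringE idealE] := (valuation_ring_subgroup lE, valuation_ideal_subgroup lE).
have ringS (I' : finType) (u : I' -> K) :
    (forall i, valuation_ring E absE (u i)) -> valuation_ring E absE (\sum_i u i).
  move=> hu; apply: (big_ind (valuation_ring E absE)) => //; first exact: ringE.1.
  by move=> *; exact: subgroupD.
have idealS (I' : finType) (u : I' -> K) :
    (forall i, valuation_ideal E absE (u i)) -> valuation_ideal E absE (\sum_i u i).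
  move=> hu; apply: (big_ind (valuation_ideal E absE)) => //; first exact: idealE.1.
  by move=> *; exact: subgroupD.
have ideal_incl x : valuation_ideal F absF x -> valuation_ideal E absE x.
  by rewrite -idealFE => -[/FE].
pose s (g : {ffun 'I_f -> I}) := \sum_j r (g j) * b j.
have sB g (a : 'I_f -> K) :
    \sum_j a j * b j - s g = \sum_j (a j - r (g j)) * b j.
  by rewrite -sumrB; apply: eq_bigr => j _; rewrite mulrBl.
have hs : coset_reps (valuation_ring E absE) (valuation_ideal E absE) s.
  split=> [g|x xO|g g'].
  - apply: ringS => j; have := rO (g j); rewrite -ringFE => -[/FE rE r1].
    have [bE b1] := bO j; split; first exact: (subfieldM (lf_subfield lE)).
    by rewrite (lf_absM lE)// mulr_ile1// (lf_abs_ge0 lE).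
  - have [a aO xa] := bspan _ xO.
    have /choice[g hg] j : exists i, valuation_ideal F absF (a j - r i).
      by apply: rOm; rewrite -ringFE.
    exists (finfun g); rewrite -[x](subrK (\sum_i a i * b i)) -addrA.
    apply: subgroupD => //; rewrite sB; apply: idealS => j.
    by apply: valuation_idealM => //; apply: ideal_incl; rewrite ffunE.
  - rewrite [s g]/s sB => h; apply/ffunP => j; apply: rinj; rewrite -idealFE.
    by apply: (bfree (fun j => r (g j) - r (g' j))) => // i; rewrite ringFE;
      exact: (valuation_ring_subgroup lF).2.
have [_] := coset_reps_index idealE hs.
by rewrite card_ffun card_ord.
Qed.

End ResidueDegree.

(** * Duality between the tower and its projective limit *)

Section TowerTheory.
Variables (R : realType) (K : fieldType) (tw : tower R K).
Implicit Types (i j n : nat) (x y xi : K).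

Local Notation KK := (tK tw).
Local Notation m := (tdeg tw).
Local Notation q := (tq tw).
Local Notation dd := (tdiff tw).
Local Notation lf := (tower_local tw).

Lemma tower_subfield i : GRing.divring_closed (KK i).
Proof. exact: lf_subfield (lf i). Qed.
Let hK := tower_subfield.

Lemma tower_sub_le i j : (i <= j)%N -> {subset KK i <= KK j}.
Proof.
elim: j => [|j ih]; first by rewrite leqn0 => /eqP ->.
rewrite leq_eqVlt => /predU1P[->//|]; rewrite ltnS => /ih h x /h.
exact: tower_sub.
Qed.

Lemma natK_eq0 n : (n%:R == 0 :> K) = (n == 0)%N.
Proof. by apply: (pcharf0P _).1; exact: tower_char0 tw. Qed.

Lemma tdeg0 : m 0 = 1%N.
Proof.
have [b hb] := tower_deg tw 0.
apply: (is_basis_size (hK 0) _ hb (is_basis_self (hK 0))).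
exact: tower_char0 tw.
Qed.

Lemma tower_basis i j : (i <= j)%N ->
  exists e (c : 'I_e -> K), is_basis (KK i) (KK j) c.
Proof.
move=> ij; have [b hb] := tower_deg tw j.
exact: (is_basis_exists (hK i) (tower_sub_le (leq0n i)) hb).
Qed.

Lemma tdeg_gt0 i : (0 < m i)%N.
Proof.
have [b [_ _ bspan]] := tower_deg tw i; rewrite lt0n; apply/eqP => mi0.
have [a _] := bspan 1 (subfield1 (hK i)).
rewrite big1 => [/eqP|j _]; first by rewrite oner_eq0.
by exfalso; have := leq_ltn_trans (leq0n j) (ltn_ord j); rewrite mi0.
Qed.

(** Degrees multiply, so relative degree 0 or 1 has to be excluded. With a single basis vector, both
    1 and [y] are multiples of it over [KK i], which would put [y] in [KK i]. *)
Lemma tdeg_succ i : (m i < m i.+1)%N.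
Proof.
have [b hb] := tower_deg tw i; have [e [c hc]] := tower_basis (leqnSn i).
have [b' hb'] := tower_deg tw i.+1.
have := is_basis_mul (hK i) (hK i.+1) (tower_sub_le (leq0n i))
  (tower_sub_le (leqnSn i)) hb hc.
move=> /(is_basis_size (hK 0) (tower_char0 tw) hb') ->.
rewrite -[X in (X < _)%N]muln1 ltn_pmul2l ?tdeg_gt0//.
have [y yi1 /negP yi] := tower_strict tw i.
have [_ _ cspan] := hc.
case: e c hc cspan => [|[|//]] c hc cspan.
  have [a _ /esym/eqP] := cspan 1 (subfield1 (hK i.+1)).
  by rewrite big_ord0 eq_sym oner_eq0.
have [a ai a1] := cspan 1 (subfield1 (hK i.+1)).
have [u ui yu] := cspan _ yi1; case: yi.
move: a1; rewrite big_ord1 => a1.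
have -> : y = u ord0 * (a ord0)^-1.
  have a0 : a ord0 != 0.
    by apply/eqP => a0; move/eqP: a1; rewrite a0 mul0r oner_eq0.
  by rewrite yu big_ord1 -[c _](mulKf a0) -a1 mulr1.
by apply: subfieldM => //; exact: subfieldV.
Qed.

Lemma tdeg_gt i : (i < m i)%N.
Proof.
by elim: i => [|i ih]; [exact: tdeg_gt0|exact: leq_ltn_trans (tdeg_succ i)].
Qed.

Lemma tdegK_neq0 i : (m i)%:R != 0 :> K.
Proof. by rewrite natK_eq0 -lt0n tdeg_gt0. Qed.

Lemma tdegK_in i j : (m i)%:R \in KK j.
Proof. exact: subfield_nat. Qed.

Lemma tower_trace_trans i j x : (i <= j)%N -> x \in KK j ->
  ext_trace (KK 0) (KK j) x = ext_trace (KK 0) (KK i) (ext_trace (KK i) (KK j) x).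
Proof.
move=> ij xj; have [b hb] := tower_deg tw i.
have [e [c hc]] := tower_basis ij.
exact: (ext_trace_trans (hK 0) (hK i) (hK j) (tower_sub_le (leq0n i))
  (tower_sub_le ij) hb hc).
Qed.

Lemma kseq_in (x : Kbar tw) i : kseq x i \in KK i.
Proof. by case: x => x /= /asboolP[]. Qed.

Lemma kseq_div_in (x : Kbar tw) i : kseq x i / (m i)%:R \in KK i.
Proof.
apply: subfieldM => //; [exact: kseq_in|apply: subfieldV => //].
exact: tdegK_in.
Qed.

Lemma kseqE (x : Kbar tw) i j : (i < j)%N -> kseq x i = Tmap tw j i (kseq x j).
Proof. by case: x => x /= /asboolP[_]; apply. Qed.

Lemma kseqB (x y : Kbar tw) i : kseq (x - y) i = kseq x i - kseq y i.
Proof. by []. Qed.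

Lemma kseq0 i : kseq (0 : Kbar tw) i = 0.
Proof. by []. Qed.

(** With coordinate [i] divided by [m i], the pairing is the plain trace form, to which the
    different applies. *)
Lemma pairingE i xi (x : Kbar tw) : xi \in KK i ->
  pairing i xi x = ext_trace (KK 0) (KK i) (xi * (kseq x i / (m i)%:R)).
Proof.
move=> xii; have xi' := kseq_in x i; rewrite /pairing /Tmap tdeg0 mul1r.
rewrite -ext_traceZ//; first by rewrite mulrC mulrA.
- by apply: subfieldV => //; exact: tdegK_in.
- exact: subfieldM.
Qed.

Lemma pairing_in i xi (x : Kbar tw) : pairing i xi x \in KK 0.
Proof.
rewrite /pairing /Tmap; apply: subfieldM => //; last exact: ext_trace_in.
by apply: subfieldM => //; last apply: subfieldV => //; exact: tdegK_in.
Qed.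

Lemma pairingB i xi (x y : Kbar tw) : xi \in KK i ->
  pairing i xi (x - y) = pairing i xi x - pairing i xi y.
Proof.
move=> xii; rewrite /pairing kseqB mulrBr TmapB//.
all: by apply: subfieldM => //; exact: kseq_in.
Qed.

Lemma pairingBl i xi xi' (x : Kbar tw) : xi \in KK i -> xi' \in KK i ->
  pairing i (xi - xi') x = pairing i xi x - pairing i xi' x.
Proof.
move=> xii xi'i; rewrite /pairing mulrBl TmapB//.
all: by apply: subfieldM => //; exact: kseq_in.
Qed.

Lemma pairingZ i a xi (x : Kbar tw) : a \in KK 0 -> xi \in KK i ->
  pairing i (a * xi) x = a * pairing i xi x.
Proof.
move=> a0 xii; have xk := subfieldM (hK i) xii (kseq_in x i).
by rewrite /pairing /Tmap -(mulrA a) ext_traceZ// mulrCA.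
Qed.

Lemma pairing_le i j xi (x : Kbar tw) : (i <= j)%N -> xi \in KK i ->
  pairing i xi x = pairing j xi x.
Proof.
rewrite leq_eqVlt => /predU1P[->//|ij] xii; have ij' := ltnW ij.
have xij := tower_sub_le ij' xii.
rewrite !pairingE//.
have V k l : (m k)%:R^-1 \in KK l by apply: subfieldV => //; exact: tdegK_in.
have xj := kseq_div_in x j; have xj' := kseq_in x j.
rewrite [RHS](tower_trace_trans ij'); last exact: subfieldM.
rewrite [in RHS]ext_traceZ//.
congr (ext_trace _ _ (_ * _)); rewrite (kseqE x ij) /Tmap.
rewrite [kseq x j / _]mulrC ext_traceZ//.
by rewrite mulrC !mulrA mulVf ?tdegK_neq0// mul1r.
Qed.

Lemma tnorm_ge0 x : 0 <= tnorm tw x.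
Proof. by have [i /(tower_norm (t := tw)) ->] := tower_union tw x; exact: powR_ge0. Qed.

Lemma tabsE i x : x \in KK i -> tabs tw i x = tnorm tw x ^+ m i.
Proof.
move=> xi; rewrite (tower_norm xi) -powR_mulrn ?powR_ge0// -powRrM.
by rewrite mulVf ?pnatr_eq0 -?lt0n ?tdeg_gt0// powRr1// (lf_abs_ge0 (lf i)).
Qed.

Lemma tabs_le i x (r : R) : x \in KK i -> 0 <= r ->
  (tabs tw i x <= r ^+ m i) = (tnorm tw x <= r).
Proof.
by move=> xi r0; rewrite tabsE// ler_pXn2r ?tdeg_gt0// nnegrE tnorm_ge0.
Qed.

Lemma tabs_le1 i x : x \in KK i -> (tabs tw i x <= 1) = (tnorm tw x <= 1).
Proof. by move=> xi; rewrite -[1 in LHS](expr1n _ (m i)) tabs_le. Qed.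

Lemma tabs_lt1 i x : x \in KK i -> (tabs tw i x < 1) = (tnorm tw x < 1).
Proof. by move=> xi; rewrite tabsE// expr_lt1 ?tdeg_gt0// tnorm_ge0. Qed.

Lemma tower_common x y : exists i, x \in KK i /\ y \in KK i.
Proof.
have [i xi] := tower_union tw x; have [j yj] := tower_union tw y.
exists (maxn i j); split.
- by apply: (tower_sub_le _ xi); rewrite leq_maxl.
- by apply: (tower_sub_le _ yj); rewrite leq_maxr.
Qed.

Lemma tnormB x y : tnorm tw (x - y) <= Num.max (tnorm tw x) (tnorm tw y).
Proof.
have [i [xi yi]] := tower_common x y.
rewrite -(tabs_le (i := i)) ?subfieldB//; last by rewrite le_max tnorm_ge0.
apply: (le_trans (absB (lf i) xi yi)).
by rewrite ge_max !tabs_le ?le_max ?lexx ?orbT ?tnorm_ge0.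
Qed.

Lemma tnormM x y : tnorm tw (x * y) = tnorm tw x * tnorm tw y.
Proof.
have [i [xi yi]] := tower_common x y.
rewrite !(tower_norm (t := tw) (i := i))// ?subfieldM// (lf_absM (lf i))//.
by rewrite powRM ?(lf_abs_ge0 (lf i)).
Qed.

Lemma tnorm0 : tnorm tw 0 = 0.
Proof.
rewrite (tower_norm (subfield0 (hK 0))) (abs0 (lf 0)) powR0//.
by rewrite invr_eq0 pnatr_eq0 -lt0n tdeg_gt0.
Qed.

Lemma tnorm_eq0 x : tnorm tw x = 0 -> x = 0.
Proof.
have [i xi] := tower_union tw x => x0; apply/(lf_abs_eq0 (lf i)) => //.
by rewrite tabsE// x0 expr0n gtn_eqF// tdeg_gt0.
Qed.

Lemma tnormN x : tnorm tw (- x) = tnorm tw x.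
Proof.
have [i xi] := tower_union tw x.
by rewrite !(tower_norm (t := tw) (i := i)) ?subfieldN// (absN (lf i)).
Qed.

Lemma tq_gt1 i : (1 < q i)%N.
Proof. exact: residue_card_gt1 (lf i). Qed.

Lemma tq_gt0 i : 0 < (q i)%:R :> R.
Proof. by rewrite ltr0n (ltn_trans _ (tq_gt1 i)). Qed.

Lemma tqE i : q i = (q 0 ^ tinert tw i)%N.
Proof.
have [b hb] := tower_inert tw i.
apply: (residue_basis_card (lf 0) (lf i) _ _ (tower_sub_le (leq0n i)) hb).
- apply/seteqP; split=> x [x0]; have xi := tower_sub_le (leq0n i) x0.
    by rewrite (tabs_le1 xi) -(tabs_le1 x0).
  by rewrite (tabs_le1 x0) -(tabs_le1 xi).
- apply/seteqP; split=> x [x0]; have xi := tower_sub_le (leq0n i) x0.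
    by rewrite (tabs_lt1 xi) -(tabs_lt1 x0).
  by rewrite (tabs_lt1 x0) -(tabs_lt1 xi).
Qed.

Lemma tinert_gt0 i : (0 < tinert tw i)%N.
Proof.
by rewrite lt0n; apply/eqP => f0; have := tq_gt1 i; rewrite tqE f0.
Qed.

(* Powers of a uniformizer of the base field show that the value group of each
   [tK tw i] contains the powers of [q 0 ^ m i]. *)
Lemma tq_level i s : exists a, (q 0 ^ (s * m i) = q i ^ a)%N.
Proof.
have [p p0 absp] := lf_uniformizer (lf 0).
have pi := tower_sub_le (leq0n i) p0.
have absw : tabs tw i (p ^- s) = (q 0 ^ (s * m i))%:R.
  rewrite (absV (lf i)) ?subfieldX// (absX (lf i))// (tabsE pi).
  have -> : tnorm tw p = (q 0)%:R^-1 by rewrite -absp (tabsE p0) tdeg0.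
  by rewrite natrX -exprM mulnC exprVn invrK.
have [||z] := lf_value_group (lf i) (x := p ^- s).
- by rewrite subfieldV// subfieldX.
- rewrite invr_eq0 expf_neq0//; apply/eqP => pe; move: absp.
  by rewrite pe (abs0 (lf 0)) => /esym/eqP; rewrite invr_eq0 gt_eqF// tq_gt0.
rewrite absw; case: z => a.
  by rewrite -exprnP -natrX => /eqP; rewrite eqr_nat => /eqP; exists a.
rewrite NegzE -exprnN => h; exfalso.
have : 1 <= (q 0 ^ (s * m i))%:R :> R by rewrite ler1n expn_gt0 (ltnW (tq_gt1 0)).
by rewrite h leNgt invf_lt1 ?exprn_gt0 ?tq_gt0// exprn_egt1// ltr1n tq_gt1.
Qed.

Lemma tnorm_le_pow i s a x : x \in KK i -> (q 0 ^ (s * m i) = q i ^ a)%N ->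
  (tnorm tw x <= (q 0)%:R ^+ s) = (tabs tw i x <= (q i)%:R ^+ a).
Proof.
move=> xi sa; rewrite -(tabs_le xi) ?exprn_ge0 ?(ltW (tq_gt0 _))//.
by rewrite -exprM -!natrX sa.
Qed.

(* The pairing is nondegenerate: the trace form identifies a fractional ideal
   with the dual of the ideal that the different attaches to it. *)
Lemma trace_dual i s y : y \in KK i ->
  tabs tw i y <= (q i)%:R ^ (dd i) * (q 0)%:R ^- (s * m i) <->
  forall xi, xi \in KK i -> tnorm tw xi <= (q 0)%:R ^+ s ->
    tabs tw 0 (ext_trace (KK 0) (KK i) (xi * y)) <= 1.
Proof.
move=> yi; have [a sa] := tq_level i s.
have [bd dmax] := tower_diff tw i.
have qi0 : (q i)%:R != 0 :> R by rewrite gt_eqF ?tq_gt0.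
have -> : (q i)%:R ^ (dd i) * (q 0)%:R ^- (s * m i) = (q i)%:R ^ (dd i - a%:Z) :> R.
  by rewrite -natrX sa natrX expfzDr// -exprnN.
split=> [hy xi xii|h].
  rewrite (tnorm_le_pow xii sa) => xia; apply: bd; first exact: subfieldM.
  rewrite (lf_absM (lf i))//.
  have -> : dd i = a%:Z + (dd i - a%:Z) by rewrite addrC subrK.
  by rewrite expfzDr// ler_pM// (lf_abs_ge0 (lf i)).
have q1 : 1 < (q i)%:R :> R by rewrite ltr1n tq_gt1.
rewrite leNgt; apply/negP => hy.
have y0 : y != 0.
  by apply: contraTneq hy => ->; rewrite (abs0 (lf i)) -leNgt ltW// exprz_gt0// tq_gt0.
have [z zy] := lf_value_group (lf i) yi y0.
move: hy; rewrite zy ltr_eXz2l// => az.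
(* As [y] exceeds [q i ^ (dd i - a)], each [x] of absolute value at most [q i ^ (dd i + 1)] is [y]
   times an element of the ball in [h]. Then [dd i + 1] bounds traces as well, against the
   maximality of [dd i]. *)
suff /dmax : forall x, x \in KK i -> tabs tw i x <= (q i)%:R ^ (dd i + 1) ->
    tabs tw 0 (ext_trace (KK 0) (KK i) x) <= 1.
  by rewrite gerDl.
move=> x xi xd; rewrite -[x](divfK y0).
have xyi : x / y \in KK i by apply: subfieldM => //; exact: subfieldV.
apply: h => //; rewrite (tnorm_le_pow xyi sa) (lf_absM (lf i)) ?subfieldV//.
rewrite (absV (lf i))// zy ler_pdivrMr ?exprz_gt0 ?tq_gt0//.
rewrite (le_trans xd)// exprnP -expfzDr// ler_eXz2l//.
by move: az; rewrite -lezD1 => az; lia.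
Qed.

(** Raising to the power [m i] clears the real exponents, since [q i] is [q 0 ^ tinert tw i]. The
    case [s = 0] is the bound in [S0], the case [s = i.+1] the one in [Ssub tw i.+1]. *)
Lemma tnorm_le_powR i s (x : Kbar tw) :
  (tnorm tw (kseq x i) <=
     (q i)%:R `^ ((dd i)%:~R / (m i)%:R - s%:R / (tinert tw i)%:R)
     * tnorm tw (m i)%:R) =
  (tabs tw i (kseq x i / (m i)%:R) <=
     (q i)%:R ^ (dd i) * (q 0)%:R ^- (s * m i)).
Proof.
have xi := kseq_in x i.
have mi : 0 < tnorm tw (m i)%:R.
  rewrite lt0r tnorm_ge0 andbT; apply/eqP => /tnorm_eq0/eqP.
  by rewrite (negPf (tdegK_neq0 i)).
rewrite -ler_pdivrMr//.
have Vi : (m i)%:R^-1 \in KK i by apply: subfieldV => //; exact: tdegK_in.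
have -> : tnorm tw (kseq x i) / tnorm tw (m i)%:R = tnorm tw (kseq x i / (m i)%:R).
  rewrite tnormM; congr (_ * _); apply: (mulfI (lt0r_neq0 mi)).
  rewrite -tnormM !divff ?tdegK_neq0 ?lt0r_neq0//.
  by rewrite (tower_norm (subfield1 (hK 0))) (abs1 (lf 0)) powR1.
rewrite -(tabs_le (i := i)) ?powR_ge0//; last exact: subfieldM.
congr (_ <= _).
have q0 : (q i)%:R != 0 :> R by rewrite gt_eqF// tq_gt0.
have mR : (m i)%:R != 0 :> R by rewrite pnatr_eq0 -lt0n tdeg_gt0.
rewrite -powR_mulrn ?powR_ge0// -powRrM mulrBl divfK// powRB ?q0 ?implybT//.
rewrite powR_intmul ?(ltW (tq_gt0 i))//; congr (_ / _).
have fR : (tinert tw i)%:R != 0 :> R by rewrite pnatr_eq0 -lt0n tinert_gt0.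
rewrite {1}tqE natrX -powR_mulrn ?(ltW (tq_gt0 0))// -powRrM.
by rewrite mulrA mulrCA divff// mulr1 -natrM powR_mulrn ?(ltW (tq_gt0 0)).
Qed.

Lemma S0P (x : Kbar tw) : S0 tw x <-> forall i xi, xi \in KK i ->
  tnorm tw xi <= 1 -> tabs tw 0 (pairing i xi x) <= 1.
Proof.
have e i : (tnorm tw (kseq x i) <= (q i)%:R `^ ((dd i)%:~R / (m i)%:R)
     * tnorm tw (m i)%:R) <-> forall xi, xi \in KK i ->
  tnorm tw xi <= 1 -> tabs tw 0 (pairing i xi x) <= 1.
  have := tnorm_le_powR i 0 x; rewrite mul0r subr0 => ->.
  have y := kseq_div_in x i.
  rewrite (trace_dual 0 y) expr0.
  by split=> h xi xii; [rewrite pairingE//|rewrite -pairingE//]; exact: h.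
by split=> [h i|h i]; [apply/e; exact: h|apply/e => xi; exact: h].
Qed.

(** As an annihilator condition it compares across levels: passing from [n] to [n.+1] only adds test
    elements [xi], so the chain decreases although the norm bounds concern different coordinates. *)
Lemma SsubP n (x : Kbar tw) : S0 tw x -> Ssub tw n.+1 x <->
  forall xi, xi \in KK n -> tnorm tw xi <= (q 0)%:R ^+ n.+1 ->
    tabs tw 0 (pairing n xi x) <= 1.
Proof.
move=> Sx; rewrite /Ssub /=.
have y := kseq_div_in x n.
transitivity (tabs tw n (kseq x n / (m n)%:R) <=
     (q n)%:R ^ (dd n) * (q 0)%:R ^- (n.+1 * m n)).
  by rewrite -tnorm_le_powR; split=> [[]|].
rewrite (trace_dual n.+1 y).
by split=> h xi xii; [rewrite pairingE//|rewrite -pairingE//]; exact: h.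
Qed.

Lemma S0_subgroup : is_subgroup (S0 tw).
Proof.
split=> [i|x y /S0P Sx /S0P Sy].
  by rewrite kseq0 tnorm0 mulr_ge0 ?powR_ge0 ?tnorm_ge0.
apply/S0P => i xi xii xi1; rewrite pairingB//.
have := absB (lf 0) (pairing_in i xi x) (pairing_in i xi y).
by move=> /le_trans; apply; rewrite ge_max Sx// Sy.
Qed.

Lemma Ssub_S0 n : Ssub tw n `<=` S0 tw.
Proof. by case: n => [|n] x //= []. Qed.

Lemma Ssub_subgroup n : is_subgroup (Ssub tw n).
Proof.
case: n => [|n]; first exact: S0_subgroup.
have SS := S0_subgroup.
split=> [|x y Sx Sy].
  apply/SsubP => [|xi _ _]; first exact: SS.1.
  by rewrite /pairing kseq0 mulr0 -(subrr 0) TmapB ?subfield0// subrr (abs0 (lf 0)).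
have [Sx0 Sy0] := (Ssub_S0 Sx, Ssub_S0 Sy).
apply/SsubP => [|xi xii xi1]; first exact: SS.2.
rewrite pairingB//.
have := absB (lf 0) (pairing_in n xi x) (pairing_in n xi y).
move=> /le_trans; apply; rewrite ge_max.
by rewrite (SsubP n Sx0).1// (SsubP n Sy0).1.
Qed.

Lemma Ssub_succ n : Ssub tw n.+1 `<=` Ssub tw n.
Proof.
case: n => [|n] x Sx; first exact: Ssub_S0 Sx.
have Sx0 := Ssub_S0 Sx.
apply/(SsubP n Sx0) => xi xin xi1; rewrite (pairing_le x (leqnSn n))//.
apply: (SsubP n.+1 Sx0).1 => //; first exact: tower_sub xin.
by rewrite (le_trans xi1)// ler_eXn2l// ltr1n tq_gt1.
Qed.

Lemma Ssub_le k n : (k <= n)%N -> Ssub tw n `<=` Ssub tw k.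
Proof.
elim: n => [|n ih]; first by rewrite leqn0 => /eqP ->.
by rewrite leq_eqVlt => /predU1P[->//|/ih] h x /Ssub_succ/h.
Qed.

Lemma Ssub_eq0 (x : Kbar tw) : (forall n, Ssub tw n x) -> x = 0.
Proof.
move=> Sx; apply/val_inj/funext => i /=; rewrite -[RHS](kseq0 i) kseq0.
have Sx0 : S0 tw x := Sx 0%N.
have y := kseq_div_in x i.
apply/eqP/negPn/negP => xi0.
have [_ dmax] := tower_diff tw i.
(* If coordinate [i] were nonzero, every [w] in [KK i] would be a multiple of it, with a factor in
   the dual ball of some level [s]. The trace would be bounded by 1 on all of [KK i], and no largest
   exponent [dd i] could exist. *)
have h w : w \in KK i -> tabs tw 0 (ext_trace (KK 0) (KK i) w) <= 1.
  move=> wi; have y0 : kseq x i / (m i)%:R != 0.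
    by rewrite mulf_neq0 ?invr_eq0 ?tdegK_neq0.
  have xii : w / (kseq x i / (m i)%:R) \in KK i.
    by apply: subfieldM => //; exact: subfieldV.
  rewrite -[w](divfK y0) -pairingE//.
  pose s := maxn i (Num.bound (tnorm tw (w / (kseq x i / (m i)%:R)))).
  rewrite (pairing_le x (leq_maxl i _ : (i <= s)%N))//.
  apply: (SsubP s Sx0).1 => //; first exact: tower_sub_le (leq_maxl _ _) _ xii.
  apply: (le_trans (ltW (archi_boundP (tnorm_ge0 _)))).
  rewrite -natrX ler_nat (leq_trans _ (ltnW (ltn_expl s.+1 (tq_gt1 0))))//.
  by rewrite (leq_trans (leq_maxr _ _ : (_ <= s)%N)).
by have := dmax (dd i + 1) (fun w wi _ => h w wi); rewrite gerDl.
Qed.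

(* Modulo the integers of [KK n], the annihilator of [Ssub tw n.+1]. *)
Definition dual_ball n : set K :=
  [set xi | xi \in KK n /\ tnorm tw xi <= (q 0)%:R ^+ n.+1].

Lemma dual_ballE n a : (q 0 ^ (n.+1 * m n) = q n ^ a)%N ->
  dual_ball n = frac_ideal (KK n) (tabs tw n) a.
Proof.
by move=> qa; apply/seteqP; split=> x [xn h]; split=> //;
  move: h; rewrite (tnorm_le_pow xn qa).
Qed.

Lemma dual_ball_subgroup n : is_subgroup (dual_ball n).
Proof.
have [a /dual_ballE ->] := tq_level n n.+1.
exact: frac_ideal_subgroup (lf n) _.
Qed.

Lemma dual_ball_reps n : exists (I : finType) (r : I -> K),
  coset_reps (dual_ball n) (valuation_ring (KK n) (tabs tw n)) r /\
  #|I| = (q 0 ^ (n.+1 * m n))%N.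
Proof.
have [a qa] := tq_level n n.+1; rewrite (dual_ballE qa).
have [I [r]] := frac_ideal_coset_reps (lf n) 0 a; rewrite -qa add0r => h.
by exists I, r.
Qed.

(** Only finiteness: coordinate [n] embeds the quotient into a finite quotient of fractional ideals.
    The exact order comes from duality, in [SindexE]. *)
Lemma Ssub_reps n : exists (I : finType) (r : I -> Kbar tw),
  coset_reps (S0 tw) (Ssub tw n) r.
Proof.
have hS := Ssub_subgroup n.
case: n hS => [|n] hS.
  by exists unit, (fun=> 0); exact: coset_reps_refl.
have [a qa] := tq_level n n.+1.
have [I [r [hr _]]] := frac_ideal_coset_reps (lf n) (dd n - a%:Z) a.
pose f (x : Kbar tw) := kseq x n / (m n)%:R.
have fn (x : Kbar tw) : f x \in KK n by exact: kseq_div_in.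
have fS (x : Kbar tw) : S0 tw x ->
    frac_ideal (KK n) (tabs tw n) (dd n - a%:Z + a%:Z) (f x).
  move=> Sx; split=> //; rewrite subrK.
  have := tnorm_le_powR n 0 x; rewrite mul0r subr0 mul0n expr0 invr1 mulr1 => <-.
  exact: Sx.
have fSn (x : Kbar tw) : S0 tw x -> frac_ideal (KK n) (tabs tw n) (dd n - a%:Z) (f x) ->
    Ssub tw n.+1 x.
  move=> Sx [_ h]; split=> //=; rewrite tnorm_le_powR.
  by rewrite -natrX qa natrX exprnN -expfzDr// gt_eqF// tq_gt0.
have [_ rB _] := hr.
have /choice[g hg] : forall x : Kbar tw, exists j0 : I, S0 tw x ->
    frac_ideal (KK n) (tabs tw n) (dd n - a%:Z) (f x - r j0).
  move=> x; have [/fS/rB[j0 ?]|nS] := pselect (S0 tw x); first by exists j0.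
  by have [j0 _] := rB _ (fS _ S0_subgroup.1); exists j0.
apply: (coset_reps_exists_fin (g := g)) => // x y Sx Sy gxy.
apply: fSn; first exact: S0_subgroup.2.
have -> : f (x - y) = (f x - r (g x)) - (f y - r (g y)).
  by rewrite gxy opprB addrA subrK /f kseqB mulrBl.
by apply: (frac_ideal_subgroup (lf n) _).2; exact: hg.
Qed.

End TowerTheory.

(** * Characters of the projective limit *)

Section KbarMeasurability.
Variables (R : realType) (K : fieldType) (tw : tower R K).

Definition cylinder i (a : K) (e : R) : set (Kbar tw) :=
  [set x | tnorm tw (kseq x i - a) <= e].

Lemma cylinder_open i a e : 0 < e -> open (cylinder i a e).
Proof.
move=> e0; suff : Kbar_open (cylinder i a e) by [].
move=> x hx; exists i, e; split=> // y hy; rewrite /cylinder /=.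
have -> : kseq y i - a = (kseq y i - kseq x i) - (a - kseq x i).
  by ring.
rewrite (le_trans (tnormB _ _ _))// ge_max (ltW (hy _ (leqnn _))).
by rewrite -opprB tnormN.
Qed.

Lemma open_Kbar_measurable (U : set (Kbar tw)) : open U -> measurable U.
Proof. by move=> oU; exact: sub_sigma_algebra. Qed.

Lemma measurable_cylinder i a e : 0 < e -> measurable (cylinder i a e).
Proof. by move=> e0; apply: open_Kbar_measurable; exact: cylinder_open. Qed.

Lemma tower_threshold_gt0 i (s : R) :
  0 < (tq tw i)%:R `^ s * tnorm tw (tdeg tw i)%:R.
Proof.
rewrite mulr_gt0 ?powR_gt0 ?tq_gt0// lt0r tnorm_ge0 andbT.
by apply/eqP => /tnorm_eq0/eqP; rewrite (negPf (tdegK_neq0 tw i)).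
Qed.

Lemma measurable_S0 : measurable (S0 tw).
Proof.
have -> : S0 tw = \bigcap_i cylinder i 0
    ((tq tw i)%:R `^ ((tdiff tw i)%:~R / (tdeg tw i)%:R)
     * tnorm tw (tdeg tw i)%:R).
  apply/seteqP; split=> x Sx.
    by move=> i _; rewrite /cylinder /= subr0; exact: Sx.
  by move=> i; have := Sx i I; rewrite /cylinder /= subr0.
apply: bigcapT_measurable => i.
exact: measurable_cylinder (tower_threshold_gt0 _ _).
Qed.

(** [S0] is an infinite intersection of cylinders, so a coset is described as the trace on [S0] of
    an open set, a single cylinder when [n > 0]. *)
Lemma Ssub_coset_open n (a : Kbar tw) : S0 tw a ->
  exists U : set (Kbar tw), open U /\
    forall x, S0 tw x -> U x <-> Ssub tw n (x - a).
Proof.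
move=> Sa; case: n => [|n].
  exists setT; split; first exact: openT.
  by move=> x Sx; split=> // _; exact: (S0_subgroup tw).2.
exists (cylinder n (kseq a n) ((tq tw n)%:R
    `^ ((tdiff tw n)%:~R / (tdeg tw n)%:R - n.+1%:R / (tinert tw n)%:R)
    * tnorm tw (tdeg tw n)%:R)); split.
  exact: cylinder_open (tower_threshold_gt0 _ _).
move=> x Sx; rewrite /cylinder /=; split=> [h|[_ h]]; last exact: h.
by split; [exact: (S0_subgroup tw).2|exact: h].
Qed.

Lemma measurable_Ssub n : measurable (Ssub tw n).
Proof.
have [U [/open_Kbar_measurable mU hU]] := Ssub_coset_open n (S0_subgroup tw).1.
have -> : Ssub tw n = S0 tw `&` U.
  apply/seteqP; split=> x.
    move=> Sx; split; first exact: Ssub_S0 Sx.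
    by apply/hU; rewrite ?subr0//; exact: Ssub_S0 Sx.
  by move=> [Sx /(hU _ Sx)]; rewrite subr0.
exact: measurableI measurable_S0 mU.
Qed.

End KbarMeasurability.

Section Characters.
Variables (R : realType) (K : fieldType) (tw : tower R K) (chi : K -> R[i]).
Hypothesis hchi : is_rank0_character tw chi.
Local Notation KK := (tK tw).
Local Notation q := (tq tw).
Local Notation lf := (tower_local tw).
Let hK := tower_subfield tw.

Let chiD x y : x \in KK 0 -> y \in KK 0 -> chi (x + y) = chi x * chi y.
Proof. by case: hchi => h *; exact: h. Qed.
Let chi_norm x : x \in KK 0 -> `|chi x| = 1.
Proof. by case: hchi => _ h *; exact: h. Qed.
Let chi1 x : x \in KK 0 -> tabs tw 0 x <= 1 -> chi x = 1.
Proof. by case: hchi => _ _ _ h *; exact: h. Qed.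

Definition pairing_char i xi (x : Kbar tw) : R[i] := chi (pairing i xi x).

Lemma pairing_charD i xi x y : xi \in KK i ->
  pairing_char i xi (x + y) = pairing_char i xi x * pairing_char i xi y.
Proof.
move=> xii; have p0 := pairingB 0 0 xii; rewrite !subrr in p0.
rewrite /pairing_char -chiD ?pairing_in//; congr chi.
by rewrite -[y in LHS]opprK -(sub0r y) !pairingB// p0 sub0r opprK.
Qed.

Lemma pairing_charDl i xi xi' x : xi \in KK i -> xi' \in KK i ->
  pairing_char i (xi + xi') x = pairing_char i xi x * pairing_char i xi' x.
Proof.
move=> xii xi'i; have p0 : pairing i 0 x = 0.
  by rewrite -[in LHS](subrr xi) pairingBl// subrr.
rewrite /pairing_char -chiD ?pairing_in//; congr chi.
rewrite -[xi' in LHS]opprK -(sub0r xi') !pairingBl ?subfieldB ?subfield0//.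
by rewrite p0 sub0r opprK.
Qed.

Lemma pairing_char_norm i xi x : `|pairing_char i xi x| = 1.
Proof. by rewrite /pairing_char chi_norm// pairing_in. Qed.

Lemma pairing_char_Re i xi x : `|complex.Re (pairing_char i xi x)| <= 1.
Proof.
have := normc_ge_Re (pairing_char i xi x).
by rewrite pairing_char_norm -[1]/(1%:C%C) lecR.
Qed.

Lemma pairing_char_S0 i xi x : S0 tw x -> xi \in KK i -> tnorm tw xi <= 1 ->
  pairing_char i xi x = 1.
Proof. by move=> /S0P Sx xii xi1; apply: chi1; [exact: pairing_in|exact: Sx]. Qed.

Lemma pairing_char_Ssub n xi x : Ssub tw n.+1 x -> dual_ball tw n xi ->
  pairing_char n xi x = 1.
Proof.
move=> Sx [xii xi1]; apply: chi1; first exact: pairing_in.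
by apply: (SsubP n (Ssub_S0 Sx)).1.
Qed.

(** [chi] is nontrivial at some [z] of absolute value at most [q 0]. A pairing value [v] of absolute
    value above 1 reaches at least [q 0], so multiplying [xi] by [z / v] stays in the ball and moves
    the value to [z]. *)
Lemma pairing_char_detect n x : S0 tw x -> ~ Ssub tw n.+1 x ->
  exists2 xi, dual_ball tw n xi & pairing_char n xi x != 1.
Proof.
move=> Sx nSx.
have [xi [xin xi1 px]] : exists xi, [/\ xi \in KK n,
    tnorm tw xi <= (q 0)%:R ^+ n.+1 & 1 < tabs tw 0 (pairing n xi x)].
  apply: contrapT => h; apply: nSx; apply/(SsubP n Sx) => xi xin xi1.
  by rewrite leNgt; apply/negP => px; apply: h; exists xi.
have [_ _ _ _ [z [z0 zq chiz]]] := hchi.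
set v := pairing n xi x in px; have v0 : v \in KK 0 by exact: pairing_in.
have vn0 : v != 0 by apply: contraTneq px => ->; rewrite (abs0 (lf 0)) ltr10.
have zv0 : z / v \in KK 0 by apply: subfieldM => //; exact: subfieldV.
have zvn := tower_sub_le (leq0n n) zv0.
exists (z / v * xi); last by rewrite /pairing_char pairingZ// divfK.
split; first exact: subfieldM.
rewrite tnormM (le_trans _ xi1)// ler_piMl ?tnorm_ge0//.
rewrite -(tabs_le1 zv0) (lf_absM (lf 0)) ?subfieldV// (absV (lf 0))//.
rewrite ler_pdivrMr ?mul1r ?(lt_trans _ px)//.
have [y vy] := lf_value_group (lf 0) v0 vn0.
apply: (le_trans zq); move: px; rewrite vy -[1]/((q 0)%:R ^ 0).
have q1 : 1 < (q 0)%:R :> R by rewrite ltr1n tq_gt1.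
by rewrite ltr_eXz2l// -[X in X <= _]expr1z ler_eXz2l.
Qed.

Lemma sum_pairing_char n x (I : finType) (r : I -> K) : S0 tw x ->
  coset_reps (dual_ball tw n) (valuation_ring (KK n) (tabs tw n)) r ->
  \sum_i pairing_char n (r i) x = if x \in Ssub tw n.+1 then #|I|%:R else 0.
Proof.
move=> Sx hr; have [rH _ _] := hr; case: ifPn => [/set_mem xS|/negP xS].
  by under eq_bigr do rewrite pairing_char_Ssub//; rewrite sumr_const.
have [|xi xiH nxi] := @pairing_char_detect n x Sx.
  by move=> h; apply: xS; exact/mem_set.
apply: (sum_character (phi := fun xi => pairing_char n xi x) (a := xi)
  (dual_ball_subgroup tw n) (valuation_ring_subgroup (lf n)) hr) => //.
- by move=> a b [an _] [bn _]; exact: pairing_charDl.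
- move=> a [an a1] _; apply: pairing_char_S0 => //.
  by rewrite -(tabs_le1 an).
Qed.

(* A character is constant on a neighbourhood of each point. *)
Lemma pairing_char_measurable (f : R[i] -> R) i xi : xi \in KK i ->
  measurable_fun setT (f \o pairing_char i xi).
Proof.
move=> xii _ A mA; rewrite setTI; apply: open_Kbar_measurable.
suff : Kbar_open ((f \o pairing_char i xi) @^-1` A) by [].
move=> x Ax.
(* In terms of the norm, [r] is the radius up to which the different guarantees integral traces. The
   [+ 1] used with [tnorm tw w] avoids a division by zero when [xi] is 0. *)
pose r : R := ((q i)%:R ^ (tdiff tw i)) `^ (tdeg tw i)%:R^-1.
have mi0 : (tdeg tw i)%:R != 0 :> R by rewrite pnatr_eq0 -lt0n tdeg_gt0.
have r0 : 0 < r by rewrite powR_gt0// exprz_gt0// tq_gt0.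
have rm : r ^+ tdeg tw i = (q i)%:R ^ (tdiff tw i).
  rewrite -powR_mulrn ?ltW// -powRrM mulVf// powRr1// ltW// exprz_gt0//.
  exact: tq_gt0.
pose w := xi / (tdeg tw i)%:R.
have wi : w \in KK i.
  by apply: subfieldM => //; apply: subfieldV => //; exact: tdegK_in.
have w1 : 0 < tnorm tw w + 1 by rewrite ltr_wpDl ?tnorm_ge0.
exists i, (r / (tnorm tw w + 1)); split; first exact: divr_gt0.
move=> y hy; suff : pairing_char i xi y = pairing_char i xi x.
  by rewrite /preimage /= => ->.
have -> : y = x + (y - x) by rewrite addrCA subrr addr0.
rewrite pairing_charD// -[RHS]mulr1; congr (_ * _).
apply: chi1; first exact: pairing_in.
rewrite pairingE//; have [bd _] := tower_diff tw i.
have di := kseq_in (y - x) i.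
have -> : xi * (kseq (y - x) i / (tdeg tw i)%:R) = w * kseq (y - x) i.
  by rewrite /w mulrA mulrAC.
apply: bd; first exact: subfieldM.
rewrite -rm tabs_le ?(ltW r0)//; last exact: subfieldM.
rewrite tnormM kseqB.
have := hy i (leqnn _); rewrite ltr_pdivlMr// mulrC => h.
by rewrite (le_trans _ (ltW h))// ler_wpM2r ?tnorm_ge0// lerDl.
Qed.

End Characters.

Section AlmostSureIntegral.
Variables (R : realType) (d : measure_display) (T : measurableType d)
  (P : probability T R).

Lemma Rintegral_ae_cst (f : T -> R) c : P.-integrable setT (EFin \o f) ->
  {ae P, forall x, f x = c} -> \int[P]_x f x = c.
Proof.
move=> fint fc; transitivity (\int[P]_(x in setT) c); last first.
  by rewrite Rintegral_cst// [X in fine X](probability_setT P) mulr1.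
rewrite /Rintegral; congr fine; apply: ae_eq_integral => //.
  exact: measurable_int fint.
by apply: filterS fc => x -> _.
Qed.

(** Orthogonality of the characters holds on [S0], hence almost everywhere; this is its integrated
    form. *)
Lemma sum_Rintegral_ae (I : finType) (f : I -> T -> R) (U : set T) c :
  (forall i, P.-integrable setT (EFin \o f i)) -> measurable U ->
  {ae P, forall x, \sum_i f i x = c * \1_U x} ->
  \sum_i \int[P]_x f i x = c * fine (P U).
Proof.
move=> fint mU fc; apply: EFin_inj.
rewrite EFinM fineK ?fin_num_measure// -sumEFin.
transitivity (\int[P]_x (\sum_i (f i x)%:E))%E.
  rewrite integral_sum//; apply: eq_bigr => i _.
  by rewrite fineK//; apply: integrable_fin_num => //; exact: fint.
transitivity (\int[P]_x (c%:E * (\1_U x)%:E))%E.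
  apply: ae_eq_integral => //.
  - by apply: emeasurable_sum => i; exact: measurable_int (fint i).
  - by apply: measurable_funeM; apply/measurable_EFinP; exact: measurable_indic.
  - by apply: filterS fc => x fx _; rewrite sumEFin -EFinM fx.
rewrite integralZl//; last first.
  apply: measurable_bounded_integrable; rewrite ?fin_num_fun_lty//.
  exists 1; split=> // M M1 x _ /=; rewrite indicE ger0_norm//.
  by apply: (le_trans _ (ltW M1)); case: (_ \in _).
by rewrite integral_indic// setIT.
Qed.

End AlmostSureIntegral.

(** * Order of the quotients and exit probabilities of the semigroup *)

Section Semigroup.
Variables (R : realType) (K : fieldType) (tw : tower R K) (chi : K -> R[i]).
Variables (alpha : R) (mu : R -> probability (Kbar tw) R).
Hypotheses (hchi : is_rank0_character tw chi) (halpha : 0 < alpha)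
  (hmu : is_stable_semigroup chi alpha mu).
Local Notation KK := (tK tw).
Local Notation q := (tq tw).
Local Notation lf := (tower_local tw).
Local Notation re_char n xi := (fun x => complex.Re (pairing_char chi n xi x)).

Lemma integrable_char h n xi : xi \in KK n ->
  (mu h).-integrable setT (EFin \o re_char n xi).
Proof.
move=> xin; apply: measurable_bounded_integrable => //.
- exact: fin_num_fun_lty.
- exact: (pairing_char_measurable hchi (complex.Re (R:=R)) xin).
- exists 1; split=> // M M1 x _ /=; apply: (le_trans _ (ltW M1)).
  exact: pairing_char_Re.
Qed.

Lemma integral_char h n xi : 0 < h -> xi \in KK n ->
  \int[mu h]_x complex.Re (pairing_char chi n xi x) =
  if 1 < tnorm tw xi then expR (- h * tnorm tw xi `^ alpha) else 1.
Proof.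
by move=> h0 xin; have /(congr1 (@complex.Re R)) := ss_fourier hmu h0 xin.
Qed.

Lemma ae_S0 h : 0 < h -> {ae mu h, forall x, S0 tw x}.
Proof.
move=> h0; exists (~` S0 tw); split; last by [].
- by apply: measurableC; exact: measurable_S0.
- exact: (ss_concentrated hmu).
Qed.

(** A character trivial on [S0] would have integral 1 against [mu 1], whereas the Fourier transform
    is [expR] of a negative number. *)
Lemma pairing_char_neq1 n xi : xi \in KK n -> 1 < tnorm tw xi ->
  exists2 x, S0 tw x & pairing_char chi n xi x != 1.
Proof.
move=> xin xi1; apply: contrapT => triv.
have := integral_char ltr01 xin; rewrite xi1.
rewrite (Rintegral_ae_cst (c := 1)); last first.
- apply: filterS (ae_S0 ltr01) => x Sx.
  suff -> : pairing_char chi n xi x = 1 by [].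
  by apply/eqP/negPn/negP => h; apply: triv; exists x.
- exact: integrable_char.
move=> /esym/eqP; rewrite -[X in _ == X]expR0 (inj_eq (@expR_inj R)).
rewrite mulN1r oppr_eq0 powR_eq0.
by rewrite gt_eqF ?(lt_trans _ xi1).
Qed.

Lemma pairing_char_sum_S0 n xi (J : finType) (s : J -> Kbar tw) :
  dual_ball tw n xi -> coset_reps (S0 tw) (Ssub tw n.+1) s ->
  \sum_j pairing_char chi n xi (s j) = if tnorm tw xi <= 1 then #|J|%:R else 0.
Proof.
move=> [xin xi1] hs; have [sS _ _] := hs; case: leP => [x1|x1].
  under eq_bigr do rewrite (pairing_char_S0 hchi)//.
  by rewrite sumr_const.
have [x Sx nx] := pairing_char_neq1 xin x1.
apply: (sum_character (phi := pairing_char chi n xi) (a := x)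
  (S0_subgroup tw) (Ssub_subgroup tw n.+1) hs) => //.
- by move=> a b _ _; exact: pairing_charD.
- by move=> a Sa _; exact: (pairing_char_Ssub hchi Sa).
Qed.

(* Counting in two ways: summing the pairing over both quotients. *)
Lemma SindexE n : Sindex tw n.+1 = (q 0 ^ (n.+1 * tdeg tw n))%N.
Proof.
have [I [r [hr <-]]] := dual_ball_reps tw n.
have [J [s hs]] := Ssub_reps tw n.+1.
have [_] := coset_reps_index (Ssub_subgroup tw n.+1) hs.
rewrite /Sindex => ->.
have [i0 hi0] := coset_reps_unique (dual_ball_subgroup tw n)
  (valuation_ring_subgroup (lf n)) hr.
have [j0 hj0] := coset_reps_unique (S0_subgroup tw) (Ssub_subgroup tw n.+1) hs.
have [rH _ _] := hr; have [sS _ _] := hs.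
have : \sum_i \sum_j pairing_char chi n (r i) (s j) =
       \sum_j \sum_i pairing_char chi n (r i) (s j) by exact: exchange_big.
under eq_bigr do rewrite (pairing_char_sum_S0 (rH _) hs).
under [in RHS]eq_bigr do rewrite (sum_pairing_char hchi (sS _) hr).
(* One term survives on each side: the class [i0] of the integers contributes [#|J|], and the class
   [j0] of 0 contributes [#|I|]. *)
rewrite -!big_mkcond /= (big_pred1 i0) => [|i]; last first.
  rewrite /= -(tabs_le1 (rH i).1); apply/idP/eqP => [h|ii0].
    by apply/hi0; split=> //; exact: (rH i).1.
  by have [] := (hi0 i).2 ii0.
rewrite (big_pred1 j0) => [|j]; last first.
  by apply/idP/eqP => [/set_mem/hj0|/hj0/mem_set].
by move=> /eqP; rewrite eqr_nat => /eqP.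
Qed.

Lemma semigroup_Ssub h n : 0 < h ->
  (mu h (~` Ssub tw n.+1) <= (h * ((q 0)%:R ^+ n.+1) `^ alpha)%:E)%E.
Proof.
move=> h0; have [I [r [hr cI]]] := dual_ball_reps tw n.
have [rH _ _] := hr.
have mS : measurable (Ssub tw n.+1) by exact: measurable_Ssub.
have I0 : 0 < #|I|%:R :> R.
  by rewrite cI ltr0n expn_gt0 (ltn_trans _ (tq_gt1 tw 0)).
have sumE : \sum_i \int[mu h]_x complex.Re (pairing_char chi n (r i) x) =
    #|I|%:R * fine (mu h (Ssub tw n.+1)).
  apply: sum_Rintegral_ae => //.
    by move=> i; apply: integrable_char; exact: (rH i).1.
  apply: filterS (ae_S0 h0) => x Sx.
  have ReD (z w : R[i]) : complex.Re (z + w) = complex.Re z + complex.Re w.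
    by case: z w => [a b] [c d].
  have /(congr1 (@complex.Re R)) := sum_pairing_char hchi Sx hr.
  rewrite (big_morph _ ReD (erefl : complex.Re 0 = 0)) => ->.
  rewrite indicE; case: (x \in _); last by rewrite mulr0.
  have ReN k : complex.Re (k%:R : R[i]) = k%:R.
    by elim: k => // k ih; rewrite -addn1 !natrD ReD ih.
  by rewrite mulr1 ReN.
set c := _ `^ _.
(* Each Fourier coefficient is at least [1 - h * c], because [expR (- u) >= 1 - u] and the norms of
   the [r i] are at most [q 0 ^ n.+1]. *)
have : #|I|%:R * (1 - h * c) <= #|I|%:R * fine (mu h (Ssub tw n.+1)).
  rewrite -sumE -[#|I|%:R]sumr_const mulr_suml; apply: ler_sum => i _.
  rewrite mul1r integral_char//; last exact: (rH i).1.
  have c0 : 0 <= c by exact: powR_ge0.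
  case: ifPn => [x1|_]; last by rewrite gerBl mulr_ge0// ltW.
  apply: (le_trans _ (expR_ge1Dx _)); rewrite mulNr lerD2l lerN2.
  rewrite ler_wpM2l ?(ltW h0)//; apply: ge0_ler_powR; rewrite ?(ltW halpha)//.
  - by rewrite nnegrE tnorm_ge0.
  - by rewrite nnegrE exprn_ge0.
  - exact: (rH i).2.
rewrite ler_pM2l// probability_setC// => h1.
rewrite -[X in (_ - X)%E]fineK ?fin_num_measure//.
by rewrite -EFinB lee_fin lerBlDr -lerBlDl.
Qed.

End Semigroup.

(** * Sets meeting few cosets have dimension zero *)

Section Numeric.
Variable R : realType.

(** The exponent of 2 is linear in [n] on one side and quadratic on the other; the quadratic one
    wins beyond a threshold [a], and [D] absorbs the terms before it. *)
Lemma powR_superexp (M : nat -> nat) (s b : R) : 0 < s -> 1 <= b ->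
  (forall n, 2 ^ (n * n) <= M n)%N ->
  exists2 D : R, 0 < D & forall n, b ^+ n * ((M n)%:R^-1) `^ s <= D * 2^-1 ^+ n.
Proof.
move=> s0 b1 hM.
(* For [n > a] the choice of [k] and [a] gives [(2 * b) ^ n <= 2 ^ (k * n) <= 2 ^ (s * a * n) <= 2 ^
   (s * n * n) <= M n ^ s]. The 2 next to [b] yields the factor [2^-1 ^+ n]. *)
have [k hk] : exists k, 2 * b <= 2 ^+ k.
  have b0 : 0 <= 2 * b by rewrite mulr_ge0// (le_trans _ b1).
  exists (Num.bound (2 * b)); rewrite (le_trans (ltW (archi_boundP b0)))//.
  by rewrite -natrX ler_nat ltnW// ltn_expl.
have [a ha] : exists a : nat, k%:R <= s * a%:R.
  have ks0 : 0 <= k%:R / s by rewrite divr_ge0// ltW.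
  exists (Num.bound (k%:R / s)).
  by rewrite mulrC -ler_pdivrMr// ltW// archi_boundP.
have b2 : 1 <= 2 * b by rewrite (le_trans b1)// ler_peMl ?ler1n// (le_trans _ b1).
exists ((2 * b) ^+ a); first by rewrite exprn_gt0// (lt_le_trans ltr01).
move=> n; have M0 : 0 < (M n)%:R :> R.
  by rewrite ltr0n (leq_trans _ (hM n))// expn_gt0.
rewrite exprVn ler_pdivlMr ?exprn_gt0// mulrAC -exprMn [b * 2]mulrC.
rewrite -powR_inv1 ?(ltW M0)// -powRrM mulN1r powRN ler_pdivrMr ?powR_gt0//.
have [na|an] := leqP n a.
  rewrite (le_trans (ler_weXn2l b2 na))// ler_peMr ?exprn_ge0 ?(le_trans _ b2)//.
  rewrite -[leLHS](powRr0 (M n)%:R) ler_powR ?(ltW s0)//.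
  by rewrite ler1n -(ltr0n R).
apply: (@le_trans _ _ ((M n)%:R `^ s)); last first.
  by rewrite ler_peMl ?powR_ge0// exprn_ege1.
apply: (@le_trans _ _ ((2 ^+ (n * n)) `^ s)); last first.
  rewrite ge0_ler_powR ?(ltW s0) ?nnegrE ?exprn_ge0//.
  by rewrite -natrX ler_nat.
apply: (@le_trans _ _ ((2 ^+ k) ^+ n)).
  by rewrite lerXn2r ?nnegrE ?(le_trans _ b2)// ?exprn_ge0.
rewrite -[2 ^+ (n * n)]powR_mulrn// -powRrM -exprM -powR_mulrn// ler_powR ?ler1n//.
rewrite !natrM mulrC -mulrA ler_wpM2l//.
by rewrite (le_trans ha)// mulrC ler_wpM2r ?(ltW s0)// ler_nat ltnW.
Qed.

Lemma sum_half_le m : \sum_(0 <= i < m) 2^-1 ^+ i <= 2 :> R.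
Proof.
rewrite (_ : \sum_(0 <= i < m) _ = 2 - 2 * 2^-1 ^+ m).
  by rewrite gerBl mulr_ge0// exprn_ge0// invr_ge0.
elim: m => [|m ih]; first by rewrite big_nil expr0 mulr1 subrr.
by rewrite big_nat_recr//= ih exprS mulrA divff//; ring.
Qed.

(** Grouped by the level [k j], the terms are dominated by a geometric series starting at [n0]. *)
Lemma sum_fibers_geometric (J : finType) (k : J -> nat) (g : nat -> R) D n0 :
  0 <= D -> (forall n, #|[pred j | k j == n]|%:R * g n <= D * 2^-1 ^+ n) ->
  (forall j, (n0 <= k j)%N) -> \sum_j g (k j) <= D * 2^-1 ^+ n0 * 2.
Proof.
move=> D0 hg hk; pose N := (\max_j k j).+1.
have kN j : (k j < N)%N by rewrite ltnS leq_bigmax.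
rewrite (partition_big (fun j => Ordinal (kN j)) xpredT)//=.
apply: (@le_trans _ _ (\sum_(i < N) (if (n0 <= i)%N then D * 2^-1 ^+ i else 0))).
  apply: ler_sum => i _.
  rewrite (eq_bigr (fun=> g i)) => [|j /eqP <-//].
  rewrite sumr_const -(mulr_natl (g _)) (@eq_card _ _ [pred j | k j == i])//.
  case: ifPn => [_|]; first exact: hg.
  rewrite -ltnNge => ni; rewrite eq_card0 ?mul0r// => j.
  by rewrite !inE gtn_eqF// (leq_trans ni).
rewrite -(big_mkord xpredT (fun i => if (n0 <= i)%N then D * 2^-1 ^+ i else 0)).
have [nN|Nn] := leqP n0 N; last first.
  rewrite big1_seq ?mulr_ge0 ?exprn_ge0// => i; rewrite mem_index_iota => /andP[_ iN].
  by rewrite leqNgt (ltn_trans _ Nn).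
rewrite (big_cat_nat (leq0n n0) nN)//= big_nat big1 ?add0r => [|i /andP[_ ni]].
  rewrite -{1}[n0]add0n big_addn.
  rewrite (eq_bigr (fun i => D * 2^-1 ^+ n0 * 2^-1 ^+ i)) => [|i _].
    by rewrite -mulr_sumr ler_wpM2l ?sum_half_le// mulr_ge0// exprn_ge0.
  by rewrite leq_addl addnC exprD mulrA.
by rewrite leqNgt ni.
Qed.

End Numeric.

Lemma subrACA (V : zmodType) (x y z t : V) :
  (x - y) - (z - t) = (x - z) - (y - t).
Proof. by rewrite !opprB addrACA [RHS]addrACA [- y + _]addrC. Qed.

Section ThinSets.
Variables (R : realType) (K : fieldType) (tw : tower R K).
Local Notation S := (S0 tw).
Local Notation M := (Sindex tw).
Hypothesis hM : forall n, M n.+1 = (tq tw 0 ^ (n.+1 * tdeg tw n))%N.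
Implicit Types (A B : set (Kbar tw)) (x y : Kbar tw).

Let M0 : M 0 = 1%N.
Proof.
have := coset_reps_refl (S0_subgroup tw).
by move=> /(coset_reps_index (S0_subgroup tw))[_]; rewrite card_unit.
Qed.

Let Mge n : (2 ^ (n * n) <= M n)%N.
Proof.
case: n => [|n]; first by rewrite M0.
rewrite hM (leq_trans (n := tq tw 0 ^ (n.+1 * n.+1)))//.
  by rewrite leq_exp2r// tq_gt1.
by rewrite leq_exp2l ?tq_gt1// leq_mul2l tdeg_gt.
Qed.

Let Mgt0 n : 0 < (M n)%:R :> R.
Proof. by rewrite ltr0n (leq_trans _ (Mge n))// expn_gt0. Qed.

Let Mle k n : (k <= n)%N -> (M k <= M n)%N.
Proof.
elim: n => [|n ih]; first by rewrite leqn0 => /eqP ->.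
rewrite leq_eqVlt => /predU1P[->//|/ih]/leq_trans; apply.
case: n {ih} => [|n]; first by rewrite M0 -(ltr0n R).
rewrite !hM leq_exp2l ?tq_gt1//; apply: leq_mul => //.
exact/ltnW/tdeg_succ.
Qed.

Lemma Sabs_Ssub n x : Ssub tw n x -> Sabs x <= (M n)%:R^-1.
Proof.
move=> Sx; rewrite /Sabs; have [_|x0] := eqVneq x 0; first by rewrite invr_ge0 ltW.
case: ifPn => [/negP x1|/negPn x1].
  case: n Sx => [|n] Sx; first by rewrite M0 invr1.
  by case: x1; apply/mem_set; exact: Ssub_le Sx.
rewrite lef_pV2 ?posrE// ler_nat.
(* A nonzero point of [Ssub tw 1] leaves the chain at some level, by [Ssub_eq0], so the default
   value of [xget] does not occur. *)
case: xgetP => [k _ [k0 [Sk nSk]]|none].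
  apply: Mle; rewrite leqNgt; apply/negP => kn; apply: nSk.
  exact: Ssub_le kn _ Sx.
exfalso; move/negP: x0; apply; apply/eqP; apply: Ssub_eq0; elim=> [|k ih].
  by apply: Ssub_S0; apply/set_mem: x1.
apply: contrapT => nSk; case: k ih nSk => [|k] ih nSk.
  by apply: nSk; exact/set_mem.
by apply: (none k.+1).
Qed.

Lemma Sdist_Ssub n x y : Ssub tw n (x - y) -> Sdist tw x y <= (M n)%:R^-1.
Proof. exact: Sabs_Ssub. Qed.

(* At most [L] cosets of [Ssub tw n] meet [A]; families of inequivalent points
   avoid having to know beforehand that this number is finite. *)
Definition coset_count_le A n (L : R) := forall (I : finType) (y : I -> Kbar tw),
  (forall i, A (y i)) -> (forall i j, Ssub tw n (y i - y j) -> i = j) ->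
  #|I|%:R <= L.

Section Thin.
Variables (A : set (Kbar tw)) (C b s : R).
Hypotheses (AS : A `<=` S) (b1 : 1 <= b) (s0 : 0 < s).
Hypothesis hA : forall n, coset_count_le A n (C * b ^+ n).

Let C0 : 0 <= C.
Proof.
have := @hA 0%N void (@of_void _).
by rewrite card_void expr0 mulr1; apply; case.
Qed.

Lemma Ssub0 n : Ssub tw n 0. Proof. exact: (Ssub_subgroup tw n).1. Qed.

(** A ball of radius at least [(M k)^-1] contains the coset of [Ssub tw k] through its centre, so
    disjoint balls of this size have inequivalent centres. Hence at most [C * b ^+ k] balls have
    level [k], that is, radius between [(M k)^-1] and [(M k.-1)^-1]. *)
Lemma packing_pre_thin B : B `<=` A -> packing_pre S (Sdist tw) s B = 0%E.
Proof.
move=> BA; apply/eqP; rewrite eq_le; apply/andP; split; last first.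
  apply/ereal_infP => _ [d _ <-]; apply: ereal_sup_ubound.
  exists set0, (fun=> 0), (fun=> 0); split; last by rewrite esum_set0.
  by split=> // i j [].
have [D D0 hD] := powR_superexp s0 b1 Mge.
(* The extra [b] appears because balls of level [n.+1] are counted modulo [Ssub tw n.+1] while their
   radius is only bounded by [(M n)^-1]; the power of 2 comes from the [2 * r] in packing sums. *)
pose E := C * b * 2 `^ s * D.
have E0 : 0 <= E by rewrite !mulr_ge0 ?powR_ge0 ?(le_trans _ b1)// ltW.
have key n0 : (packing_pre S (Sdist tw) s B <= (E * 2^-1 ^+ n0 * 2)%:E)%E.
  (* Halving forces levels strictly above [n0]; a radius equal to [(M n0)^-1] would have level at
     most [n0]. *)
  apply: (@le_trans _ _ (packing_pre_delta S (Sdist tw) s ((M n0)%:R^-1 / 2) B)).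
    apply: ereal_inf_lbound; exists ((M n0)%:R^-1 / 2) => //=.
    by rewrite divr_gt0// invr_gt0.
  apply: ge_ereal_sup => _ [I [x [r [[xB rd xtriv] ->]]]].
  apply: ge_ereal_sup => _ [X [finX XI] <-].
  rewrite fsbig_finite//= big_seq_fsetE/= sumEFin lee_fin.
  have YI (j : fset_set X) : I (val j).
    by apply: XI; apply/set_mem; rewrite -in_fset_set// (valP j).
  have ex (j : fset_set X) : exists n, (M n)%:R^-1 <= r (val j).
    have [r0 _] := andP (rd _ (YI j)).
    exists (Num.bound (r (val j))^-1).
    rewrite -[leRHS]invrK lef_pV2 ?posrE ?invr_gt0//.
    rewrite (le_trans (ltW (archi_boundP _))) ?invr_ge0 ?(ltW r0)//.
    rewrite ler_nat (leq_trans _ (Mge _))// (leq_trans (ltnW (ltn_expl _ (ltnSn 1))))//.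
    by rewrite leq_exp2l//; case: (Num.bound _) => // k; rewrite leq_pmulr.
  pose k j := ex_minn (ex j).
  have kr j : (M (k j))%:R^-1 <= r (val j) by rewrite /k; case: ex_minnP.
  have rk j n : (n < k j)%N -> r (val j) < (M n)%:R^-1.
    rewrite /k; case: ex_minnP => i _ imin; rewrite ltnNge => ni.
    by rewrite ltNge; apply: contraNN ni; exact: imin.
  have kn0 j : (n0 < k j)%N.
    rewrite ltnNge; apply/negP => /Mle kn.
    have [_ rd'] := andP (rd _ (YI j)).
    have : (M n0)%:R^-1 <= (M n0)%:R^-1 / 2 :> R.
      by rewrite (le_trans _ rd')// (le_trans _ (kr j))// lef_pV2 ?posrE// ler_nat.
    by rewrite ler_pMr ?invr_gt0// leNgt invf_lt1// ltr1n.
  pose g n : R := 2 `^ s * (M n)%:R^-1 `^ s.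
  apply: (@le_trans _ _ (\sum_j g (k j).-1)).
    apply: ler_sum => j _; have [r0 _] := andP (rd _ (YI j)).
    rewrite /g -powRM ?invr_ge0 ?(ltW (Mgt0 _))// ge0_ler_powR ?(ltW s0)//.
    - by rewrite nnegrE mulr_ge0// ltW.
    - by rewrite nnegrE mulr_ge0// invr_ge0 ltW.
    - by rewrite ler_pM2l// ltW// rk// prednK// (leq_ltn_trans _ (kn0 j)).
  apply: sum_fibers_geometric => // [n|j]; last first.
    by rewrite -ltnS prednK// (leq_ltn_trans _ (kn0 j)).
  apply: (@le_trans _ _ (C * b ^+ n.+1 * g n)).
    rewrite ler_wpM2r ?mulr_ge0 ?powR_ge0//.
    pose J := {j : fset_set X | (k j).-1 == n}.
    rewrite -card_sig; apply: (@hA n.+1 J (fun j => x (val (val j)))).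
      by move=> j; apply: BA; exact/xB/YI.
    have kJ (j : J) : k (val j) = n.+1.
      have /eqP kn : (k (val j)).-1 == n := valP j.
      rewrite -[LHS]prednK; first by rewrite kn.
      by rewrite (leq_ltn_trans _ (kn0 _)).
    move=> i j Sij; apply: val_inj; apply: val_inj; apply: (xtriv _ _ (YI _) (YI _)).
    exists (x (val (val j))); split.
    - split; first by apply/AS/BA/xB.
      by rewrite (le_trans (Sdist_Ssub Sij))// -(kJ i).
    - split; first by apply/AS/BA/xB.
      have Sjj : Ssub tw n.+1 (x (val (val j)) - x (val (val j))).
        by rewrite subrr; exact: Ssub0.
      by rewrite (le_trans (Sdist_Ssub Sjj))// -(kJ j).
  rewrite /g /E exprS; have := hD n.
  have -> : C * (b * b ^+ n) * (2 `^ s * (M n)%:R^-1 `^ s) =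
    (C * b * 2 `^ s) * (b ^+ n * (M n)%:R^-1 `^ s) by ring.
  rewrite -[_ * D * _]mulrA; apply: ler_wpM2l.
  by rewrite !mulr_ge0 ?powR_ge0// (le_trans _ b1).
apply/lee_addgt0Pr => e e0; rewrite add0e.
have [n0 hn0] : exists n0, E * 2^-1 ^+ n0 * 2 <= e.
  have E2 : 0 <= E * 2 / e by apply: divr_ge0; [exact: mulr_ge0|exact: ltW].
  exists (Num.bound (E * 2 / e)); rewrite mulrAC exprVn ler_pdivrMr ?exprn_gt0//.
  rewrite [e * _]mulrC -ler_pdivrMr//.
  rewrite (le_trans (ltW (archi_boundP E2)))//.
  by rewrite -natrX ler_nat ltnW// ltn_expl.
by rewrite (le_trans (key n0))// lee_fin.
Qed.

Lemma packing_measure_thin : packing_measure S (Sdist tw) s A = 0%E.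
Proof.
apply/eqP; rewrite eq_le; apply/andP; split.
  apply: ereal_inf_lbound; exists (fun i => if i is 0%N then A else set0).
    split=> [[|i]//|x Ax]; by exists 0%N.
  by rewrite eseries0// => -[|i] _ _; exact: packing_pre_thin.
apply/ereal_infP => _ [U _ <-]; apply: nneseries_ge0 => i _ _.
apply/ereal_infP => _ [d _ <-]; apply: ereal_sup_ubound.
exists set0, (fun=> 0), (fun=> 0); split; last by rewrite esum_set0.
by split=> // j k [].
Qed.

Lemma diameter_coset (U : set (Kbar tw)) n :
  (forall x y, U x -> U y -> Ssub tw n (x - y)) ->
  0 <= diameter (Sdist tw) U <= (M n)%:R^-1.
Proof.
move=> hU; rewrite /diameter; set E := (X in sup X).
have ubE : ubound E (M n)%:R^-1.
  by move=> _ [[x y] [Ux Uy] <-]; apply: Sdist_Ssub; exact: hU.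
have [->|/set0P[e Ee]] := eqVneq E set0; first by rewrite sup0 lexx invr_ge0 ltW.
apply/andP; split; last by apply: ge_sup => //; exists e.
have [[x y] [/= Ux _] _] := Ee.
have E0 : E 0 by exists (x, x) => //=; rewrite /Sdist /Sabs subrr eqxx.
by apply: ub_le_sup => //; exists (M n)%:R^-1.
Qed.

(** Covers by the cosets of a single [Ssub tw n] meeting [A] suffice: at most [C * b ^+ n] sets of
    diameter at most [(M n)^-1]. *)
Lemma hausdorff_pre_thin delta : 0 < delta ->
  hausdorff_pre S (Sdist tw) s delta A = 0%E.
Proof.
move=> d0; apply/eqP; rewrite eq_le; apply/andP; split; last first.
  apply/ereal_infP => _ [U _ <-]; apply: nneseries_ge0 => i _ _.
  by rewrite lee_fin powR_ge0.
apply/lee_addgt0Pr => e e0; rewrite add0e.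
have [D D0 hD] := powR_superexp s0 b1 Mge.
have [n nD nd] : exists2 n, C * D * 2^-1 ^+ n <= e & (M n)%:R^-1 <= delta.
  pose N := Num.max (C * D / e) delta^-1.
  have N0 : 0 <= N by rewrite le_max invr_ge0 (ltW d0) orbT.
  have Nn : N <= 2 ^+ Num.bound N.
    rewrite (le_trans (ltW (archi_boundP N0)))//.
    by rewrite -natrX ler_nat ltnW// ltn_expl.
  exists (Num.bound N).
    rewrite exprVn ler_pdivrMr ?exprn_gt0// [e * _]mulrC -ler_pdivrMr//.
    by rewrite (le_trans _ Nn)// le_max lexx.
  rewrite -[leRHS]invrK lef_pV2 ?posrE ?invr_gt0//.
  apply: (@le_trans _ _ N); first by rewrite le_max lexx orbT.
  rewrite (le_trans Nn)// -natrX ler_nat (leq_trans _ (Mge _))//.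
  by rewrite leq_exp2l//; case: (Num.bound _) => // k; rewrite leq_pmulr.
have [I [r [rS rSn rinj]]] := Ssub_reps tw n.
pose hit i := exists2 a, A a & Ssub tw n (a - r i).
(* The bound [hA] counts points of [A], so each coset meeting [A] gets a representative in [A]. *)
have /choice[y hy] i : exists y, hit i -> A y /\ Ssub tw n (y - r i).
  by have [[a Aa ai]|nh] := pselect (hit i); [exists a|exists 0].
pose J : finType := {i : I | `[< hit i >]}.
have yJ (j : J) : A (y (val j)) /\ Ssub tw n (y (val j) - r (val j)).
  by apply: hy; apply/asboolP; exact: valP j.
have cJ : #|J|%:R <= C * b ^+ n.
  apply: (@hA n J (y \o val)) => [j|i j Sij]; first exact: (yJ j).1.
  apply: val_inj; apply: rinj.
  have -> : r (val i) - r (val j) = (y (val i) - y (val j)) -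
      ((y (val i) - r (val i)) - (y (val j) - r (val j))).
    by rewrite (subrACA (y (val i)) (r (val i))) subKr.
  apply: (Ssub_subgroup tw n).2 => //.
  by apply: (Ssub_subgroup tw n).2; [exact: (yJ i).2|exact: (yJ j).2].
(* Covers are sequences: the sets numbered from [#|J|] on are empty and contribute [0 ^ s = 0]. *)
pose U k : set (Kbar tw) := [set x | A x /\
  exists2 j : J, enum_rank j = k :> nat & Ssub tw n (x - y (val j))].
have dU k : 0 <= diameter (Sdist tw) (U k) <= (M n)%:R^-1.
  apply: diameter_coset => u v [_ [j jk uj]] [_ [j' j'k vj]].
  have jj' : j = j' by apply/enum_rank_inj/val_inj; rewrite /= jk.
  have -> : u - v = (u - y (val j)) - (v - y (val j)) by rewrite opprB addrA subrK.
  by apply: (Ssub_subgroup tw n).2 => //; rewrite jj'.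
apply: (@le_trans _ _ (\sum_(0 <= i <oo) (diameter (Sdist tw) (U i) `^ s)%:E)%E).
  apply: ereal_inf_lbound; exists U => //; split=> [k x [/AS]//|x Ax|k].
  - have [i xi] := rSn _ (AS Ax).
    have hi : `[< hit i >] by apply/asboolP; exists x.
    pose j : J := exist _ i hi.
    exists (enum_rank j) => //; split=> //; exists j => //=.
    have -> : x - y i = (x - r i) - (y i - r i) by rewrite opprB addrA subrK.
    by apply: (Ssub_subgroup tw n).2 => //; exact: (yJ j).2.
  - by have /andP[_ /le_trans] := dU k; apply.
rewrite (@nneseries_split _ _ 0 #|J|) => [|k _]; last by rewrite lee_fin powR_ge0.
rewrite [X in (_ + X)%E]eseries0 => [|k Jk _]; last first.
  rewrite (_ : U k = set0).
    rewrite /diameter (_ : [set _ | _ in _] = set0) ?sup0 ?powR0 ?gt_eqF//.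
    by rewrite -subset0 => _ [[a c] [[]]].
  rewrite -subset0 => x [_ [j jk _]]; move: Jk.
  by rewrite -jk leqNgt ltn_ord.
rewrite adde0 add0n sumEFin lee_fin.
apply: (@le_trans _ _ (\sum_(0 <= k < #|J|) (M n)%:R^-1 `^ s)).
  apply: ler_sum => k _; have /andP[dU0 dU1] := dU k.
  by rewrite ge0_ler_powR ?(ltW s0) ?nnegrE ?invr_ge0 ?(ltW (Mgt0 _)).
rewrite sumr_const_nat subn0 -[leLHS]mulr_natl.
apply: (@le_trans _ _ (C * b ^+ n * (M n)%:R^-1 `^ s)).
  by rewrite ler_wpM2r ?powR_ge0.
by rewrite (le_trans _ nD)// -!mulrA ler_wpM2l.
Qed.

Lemma hausdorff_measure_thin : hausdorff_measure S (Sdist tw) s A = 0%E.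
Proof.
rewrite /hausdorff_measure; have -> : [set hausdorff_pre S (Sdist tw) s d A |
    d in [set d | 0 < d]] = [set 0%E].
  apply/seteqP; split=> [_ [d d0 <-]|_ ->]; first exact: hausdorff_pre_thin.
  by exists 1 => //=; exact: hausdorff_pre_thin.
by rewrite ereal_sup1.
Qed.

End Thin.

Lemma ereal_inf_pos : ereal_inf [set s%:E | s in [set s : R | 0 < s]] = 0%E.
Proof.
apply/eqP; rewrite eq_le; apply/andP; split.
  apply/lee_addgt0Pr => e e0; rewrite add0e.
  by apply: ereal_inf_lbound; exists e.
by apply/ereal_infP => _ [s s0 <-]; rewrite lee_fin ltW.
Qed.

Lemma thin_dim A C b : A `<=` S -> 1 <= b ->
  (forall n, coset_count_le A n (C * b ^+ n)) ->
  hausdorff_dim S (Sdist tw) A = 0%E /\ packing_dim S (Sdist tw) A = 0%E.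
Proof.
move=> AS b1 hA; split; rewrite -[RHS]ereal_inf_pos; congr ereal_inf;
  congr image; apply/seteqP; split=> [s []//|s s0]; split=> //.
- exact: hausdorff_measure_thin hA.
- exact: packing_measure_thin hA.
Qed.

End ThinSets.

(** * Counting the jumps of the process *)

Section FatouBound.
Variables (R : realType) (d : measure_display) (T : measurableType d)
  (P : probability T R).

(** Fatou's lemma makes the lower limit integrable, hence almost surely finite, and any number above
    it bounds infinitely many terms. *)
Lemma ae_frequently_bounded (F : nat -> T -> R) (B : R) :
  (forall j, measurable_fun setT (F j)) -> (forall j w, 0 <= F j w) ->
  (forall j, \int[P]_w (F j w)%:E <= B%:E)%E ->
  {ae P, forall w, exists C : R, forall j0, exists2 j, (j0 <= j)%N & F j w <= C}.
Proof.
move=> mF F0 FB.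
pose f j w := (F j w)%:E.
have mf j : measurable_fun setT (f j) by exact/measurable_EFinP.
have f0 j w : setT w -> (0 <= f j w)%E by move=> _; rewrite lee_fin.
have mlim : measurable_fun setT (fun w => limn_einf (f ^~ w)).
  under eq_fun do rewrite limn_einf_lim.
  apply: (emeasurable_fun_cvg (fun n w => einfs (f ^~ w) n)).
    by move=> n; exact: measurable_fun_einfs.
  by move=> w _; exact: is_cvg_einfs.
have lim0 w : (0 <= limn_einf (f ^~ w))%E.
  rewrite limn_einf_lim; apply: lime_ge; first exact: is_cvg_einfs.
  by apply: nearW => n; apply/ereal_infP => _ [j _ <-]; exact: f0.
have fint : P.-integrable setT (fun w => limn_einf (f ^~ w)).
  apply/integrableP; split=> //.
  under eq_integral do rewrite gee0_abs//.
  apply: (le_lt_trans (fatou P measurableT mf f0)).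
  rewrite (@le_lt_trans _ _ B%:E) ?ltry// limn_einf_lim.
  apply: lime_le; first exact: is_cvg_einfs.
  apply: nearW => n; apply: (le_trans _ (FB n)).
  by apply: ereal_inf_lbound; exists n => //=.
apply: filterS (integrable_ae measurableT fint) => w /(_ I) fin.
exists (fine (limn_einf (f ^~ w)) + 1) => j0.
have : (einfs (f ^~ w) j0 < (fine (limn_einf (f ^~ w)) + 1)%:E)%E.
  rewrite EFinD fineK//; apply: (@le_lt_trans _ _ (limn_einf (f ^~ w))).
    rewrite limn_einf_lim (cvg_lim _ (@cvg_einfs_sup _ (f ^~ w)))//.
    by apply: ereal_sup_ubound; exists j0.
  by rewrite lteDl// lte01.
by move=> /ereal_inf_lt[_ [j /= j0j <-]]; rewrite lte_fin => /ltW; exists j.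
Qed.

End FatouBound.

Section Jumps.
Variables (V : zmodType) (B : set V) (z : nat -> V).
Hypothesis hB : is_subgroup B.

Definition jump k : bool := z k.+1 - z k \notin B.

Lemma jump_free_coset a b : (a <= b)%N ->
  (\sum_(a <= k < b) jump k = 0)%N -> B (z b - z a).
Proof.
elim: b => [|b ih]; first by rewrite leqn0 => /eqP -> _; rewrite subrr; exact: hB.1.
rewrite leq_eqVlt => /predU1P[-> _|ab]; first by rewrite subrr; exact: hB.1.
rewrite big_nat_recr//= => /eqP; rewrite addn_eq0 => /andP[/eqP hab].
rewrite eqb0 negbK => /set_mem Bb.
have -> : z b.+1 - z a = (z b.+1 - z b) + (z b - z a) by rewrite addrA subrK.
by apply: subgroupD => //; exact: ih.
Qed.

(* Numbering each visited coset by the number of jumps made so far. *)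
Lemma card_cosets_le_jumps m (I : finType) (kap : I -> nat) :
  (forall i, kap i <= m)%N ->
  (forall i j, B (z (kap i) - z (kap j)) -> i = j) ->
  (#|I| <= (\sum_(0 <= k < m) jump k).+1)%N.
Proof.
move=> km kinj; set N := (\sum_(0 <= k < m) jump k)%N.
pose h i := (\sum_(0 <= k < kap i) jump k)%N.
have hN i : (h i < N.+1)%N.
  by rewrite ltnS /N (big_cat_nat (leq0n _) (km i)) leq_addr.
rewrite -[N.+1]card_ord; apply: (@leq_card _ _ (fun i => Ordinal (hN i))).
suff inj i j : h i = h j -> (kap i <= kap j)%N -> i = j.
  move=> i j [hij]; have [|/ltnW] := leqP (kap i) (kap j); first exact: inj.
  by move=> /inj h'; exact/esym/h'.
move=> hij ij; apply/esym/kinj/jump_free_coset => //; move: hij.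
rewrite /h [RHS](big_cat_nat (leq0n _) ij)/= => /eqP.
by rewrite -[X in X == _]addn0 eqn_add2l => /eqP.
Qed.

End Jumps.

Section Grid.
Variable R : realType.

Definition grid (t : R) (j k : nat) : R := t * k%:R / 2 ^+ j.

Lemma grid_ge0 t j k : 0 <= t -> 0 <= grid t j k.
Proof. by move=> t0; rewrite /grid divr_ge0 ?mulr_ge0 ?exprn_ge0. Qed.

Lemma grid_refine t i j k : (i <= j)%N ->
  grid t i k = grid t j (k * 2 ^ (j - i)).
Proof.
move=> ij; rewrite /grid natrM natrX -{2}(subnK ij) exprD invfM.
by field; rewrite !expf_neq0// pnatr_eq0.
Qed.

Lemma gridS t j k : grid t j k.+1 = grid t j k + t / 2 ^+ j.
Proof. by rewrite /grid -natr1 mulrDr mulr1 mulrDl. Qed.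

Lemma grid_approx (t s e : R) : 0 < t -> 0 <= s < t -> 0 < e ->
  exists j k, (k <= 2 ^ j)%N /\ s < grid t j k < s + e.
Proof.
(* The mesh is also kept below [t - s], so that the first grid point after [s] does not pass [t]. *)
move=> t0 /andP[s0 st] e0; pose d := Num.min e (t - s).
have d0 : 0 < d by rewrite lt_min e0 subr_gt0.
have td0 : 0 <= t / d by rewrite divr_ge0// ltW.
pose j := Num.bound (t / d).
have j2 : 0 < 2 ^+ j :> R by rewrite exprn_gt0.
have tj : t / 2 ^+ j < d.
  rewrite ltr_pdivrMr// mulrC -ltr_pdivrMr//.
  by rewrite (lt_le_trans (archi_boundP td0))// -natrX ler_nat ltnW// ltn_expl.
have u0 : 0 <= s * 2 ^+ j / t by rewrite divr_ge0 ?(ltW t0)// mulr_ge0// ltW.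
have /andP[ku uk] := truncn_itv u0; set k := Num.truncn _ in ku uk.
have sk : s < grid t j k.+1.
  by rewrite /grid ltr_pdivlMr// [t * _]mulrC -ltr_pdivrMr.
have ks : grid t j k <= s.
  by rewrite /grid ler_pdivrMr// [t * _]mulrC -ler_pdivlMr.
have kd : grid t j k.+1 < s + d by rewrite gridS ler_ltD.
exists j, k.+1; split.
  rewrite -(ler_nat R) natrX -(ler_pM2l t0) -ler_pdivrMr//.
  rewrite -/(grid _ _ _) ltW// (lt_le_trans kd)//.
  by rewrite -lerBrDl ge_min lexx orbT.
by rewrite sk (lt_le_trans kd)// lerD2l ge_min lexx.
Qed.

End Grid.

(** * Cosets visited by a path on [0, t] *)

Section Range.
Variables (R : realType) (K : fieldType) (tw : tower R K)
  (chi : K -> R[i]) (alpha : R) (mu : R -> probability (Kbar tw) R)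
  (d : measure_display) (Omega : measurableType d) (P : probability Omega R)
  (X : R -> Omega -> Kbar tw).
Hypotheses (hchi : is_rank0_character tw chi) (halpha : 0 < alpha)
  (hmu : is_stable_semigroup chi alpha mu) (hX : is_levy_process P X)
  (hlaw : forall s : R, 0 < s -> forall A : set (Kbar tw), measurable A ->
     P (X s @^-1` A) = mu s A).
Variables (t : R).
Hypothesis t0 : 0 < t.

Let c n : R := ((tq tw 0)%:R ^+ n.+1) `^ alpha.
Let E n a b : set Omega := [set w | ~ Ssub tw n.+1 (X b w - X a w)].

Let c0 n : 0 < c n.
Proof. by rewrite powR_gt0// exprn_gt0// tq_gt0. Qed.

(** An increment lies in [Ssub tw n.+1] exactly when both values lie in the same one of finitely
    many cosets, each cut out on [S0] by an open set. Measurability of each [X s] separately is then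
    enough. *)
Lemma measurable_increment n a b : 0 <= a -> 0 <= b -> measurable (E n a b).
Proof.
move=> a0 b0; rewrite /E -[X in measurable X]setCK; apply: measurableC.
have [I [r hr]] := Ssub_reps tw n.+1; have [rS rSn rinj] := hr.
have /choice[U hU] : forall i, exists U : set (Kbar tw), open U /\
    forall x, S0 tw x -> U x <-> Ssub tw n.+1 (x - r i).
  by move=> i; exact: Ssub_coset_open.
move: (Ssub tw n.+1) (Ssub_subgroup tw n.+1) rSn hU => Sn hS rSn hU {hr rinj}.
have -> : ~` [set w | ~ Sn (X b w - X a w)] =
    \bigcup_(i in [set: I]) (X a @^-1` U i `&` X b @^-1` U i).
  apply/seteqP; split=> w /=.
    move=> /contrapT Sw; have [i ai] := rSn _ (lp_values hX w a0).
    exists i => //; split.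
      exact: ((hU i).2 _ (lp_values hX w a0)).2 ai.
    apply: ((hU i).2 _ (lp_values hX w b0)).2.
    by rewrite -[X b w](subrK (X a w)) -addrA; exact: subgroupD.
  move=> [i _ []] /((hU i).2 _ (lp_values hX w a0)) wa.
  move=> /((hU i).2 _ (lp_values hX w b0)) wb; apply.
  have -> : X b w - X a w = (X b w - r i) - (X a w - r i) by rewrite opprB addrA subrK.
  exact: hS.2.
apply: fin_bigcup_measurable; first exact: finite_finset.
move=> i _; apply: measurableI.
- by rewrite -[X in measurable X]setTI; apply: (lp_measurable hX a0) => //;
    apply: open_Kbar_measurable; exact: (hU i).1.
- by rewrite -[X in measurable X]setTI; apply: (lp_measurable hX b0) => //;
    apply: open_Kbar_measurable; exact: (hU i).1.
Qed.

Lemma prob_increment n a h : 0 <= a -> 0 < h ->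
  (P (E n a (a + h)) <= (h * c n)%:E)%E.
Proof.
move=> a0 h0; have mS : measurable (~` Ssub tw n.+1).
  by apply: measurableC; exact: measurable_Ssub.
rewrite /E (lp_stationary hX a0 (ltW h0) mS).
(* Stationarity leads to [X h w - X 0 w], while the law is given for [X h w]; the two agree off the
   null set [N]. *)
have [N [mN N0 hN]] := lp_start hX.
apply: (@le_trans _ _ (P (X h @^-1` (~` Ssub tw n.+1) `|` N))).
  have mX : measurable (X h @^-1` (~` Ssub tw n.+1)).
    by rewrite -[X in measurable X]setTI; exact: (lp_measurable hX (ltW h0)).
  apply: le_measure; rewrite ?inE.
  - exact: (measurable_increment n (lexx 0) (ltW h0)).
  - exact: measurableU.
  - move=> w hw; have [Nw|Nw] := pselect (N w); [by right|left].
    have := contra_not (@hN w) Nw => /contrapT X0.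
    have : ~ Ssub tw n.+1 (X h w - X 0 w) := hw.
    by rewrite X0 subr0.
apply: (@le_trans _ _ (P (X h @^-1` (~` Ssub tw n.+1)) + P N)%E).
  apply: measureU2 => //.
  by rewrite -[X in measurable X]setTI; exact: (lp_measurable hX (ltW h0)).
by rewrite N0 adde0 hlaw//; exact: (semigroup_Ssub hchi halpha hmu).
Qed.

(** At most [t * c n] jumps are expected at level [n], so with these weights all levels together
    contribute at most [2 * t], on every grid. *)
Let wt n : R := (2 ^+ n * c n)^-1.

Let F j (w : Omega) : R := \sum_(p : 'I_j * 'I_(2 ^ j))
  wt p.1 * \1_(E p.1 (grid t j p.2) (grid t j p.2.+1)) w.

Let wt0 n : 0 < wt n. Proof. by rewrite invr_gt0 mulr_gt0// exprn_gt0. Qed.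

Let mE n j k : measurable (E n (grid t j k) (grid t j k.+1)).
Proof. by apply: measurable_increment; apply: grid_ge0; exact: ltW. Qed.

Lemma ae_jumps_bounded : {ae P, forall w, exists C : R,
  forall j0, exists2 j, (j0 <= j)%N & F j w <= C}.
Proof.
have mf j (p : 'I_j * 'I_(2 ^ j)) : measurable_fun setT (fun w =>
    wt p.1 * \1_(E p.1 (grid t j p.2) (grid t j p.2.+1)) w).
  by apply: measurable_funM; [exact: measurable_cst|exact: measurable_indic].
have f0 j (p : 'I_j * 'I_(2 ^ j)) w :
    0 <= wt p.1 * \1_(E p.1 (grid t j p.2) (grid t j p.2.+1)) w.
  by rewrite mulr_ge0// ltW.
apply: (@ae_frequently_bounded _ _ _ _ _ (2 * t)) => [j|j w|j].
- by apply: measurable_sum => p; exact: mf.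
- by apply: sumr_ge0 => p _.
under eq_integral do rewrite /F -sumEFin.
rewrite ge0_integral_sum//; last 2 first.
- by move=> p; apply/measurable_EFinP; exact: mf.
- by move=> p w _; rewrite lee_fin.
apply: (@le_trans _ _ (\sum_(p : 'I_j * 'I_(2 ^ j))
    (wt p.1 * (t / 2 ^+ j * c p.1))%:E)%E).
  apply: lee_sum => p _; under eq_integral do rewrite EFinM.
  rewrite ge0_integralZl//; last first.
  - by rewrite lee_fin ltW.
  - by apply/measurable_EFinP; exact: measurable_indic.
  rewrite integral_indic// setIT EFinM lee_wpmul2l//; first by rewrite lee_fin ltW.
  rewrite gridS; apply: prob_increment; first by apply: grid_ge0; exact: ltW.
  by rewrite divr_gt0// exprn_gt0.
rewrite sumEFin lee_fin -(pair_bigA _ (fun (i : 'I_j) (k : 'I_(2 ^ j)) =>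
  wt i * (t / 2 ^+ j * c i)))/=.
rewrite (eq_bigr (fun i : 'I_j => t * 2^-1 ^+ i)) => [|i _].
  rewrite -mulr_sumr mulrC ler_wpM2r ?(ltW t0)//.
  by rewrite -(big_mkord xpredT (fun i => 2^-1 ^+ i)) sum_half_le.
rewrite sumr_const card_ord -[LHS]mulr_natl natrX /wt exprVn.
have := c0 i; move: (c i) => ci ci0.
by field; rewrite ?expf_neq0 ?pnatr_eq0 ?gt_eqF.
Qed.

Lemma right_continuous_dyadic n w s :
  (forall s : R, 0 <= s -> X u w @[u --> s^'+] --> X s w) -> 0 <= s <= t ->
  exists j k, (k <= 2 ^ j)%N /\ Ssub tw n (X (grid t j k) w - X s w).
Proof.
move=> hc /andP[s0]; rewrite le_eqVlt => /predU1P[->|st].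
  (* At the endpoint, approximation from the right would leave the interval; there [t] is itself a
     grid point. *)
  exists 0%N, 1%N; split=> //; rewrite /grid mulr1 expr0 divr1 subrr.
  exact: Ssub0.
have Ss := lp_values hX w s0.
have [U [oU hU]] := Ssub_coset_open n Ss.
have Us : nbhs (X s w) U.
  by apply: open_nbhs_nbhs; split=> //; apply/hU; rewrite ?subrr//; exact: Ssub0.
have := hc _ s0 _ Us => -[e /= e0 he].
have s0t : 0 <= s < t by rewrite s0.
have [j [k [k2 /andP[su us]]]] := grid_approx t0 s0t e0.
exists j, k; split=> //; apply: (hU _ (lp_values hX w _)).1.
  by apply: grid_ge0; exact: ltW.
apply: he => //=.
by rewrite distrC gtr0_norm ?subr_gt0// ltrBlDl.
Qed.

Let q_ge1 : 1 <= (tq tw 0)%:R `^ alpha :> R.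
Proof.
by rewrite -[leLHS](powRr0 (tq tw 0)%:R) ler_powR ?(ltW halpha)// ler1n ltnW ?tq_gt1.
Qed.

Lemma growth_ge1 : 1 <= 2 * (tq tw 0)%:R `^ alpha :> R.
Proof. by rewrite (le_trans q_ge1)// ler_peMl ?ler1n// (le_trans _ q_ge1). Qed.

Lemma ae_coset_count : {ae P, forall w, exists C : R, forall n,
  coset_count_le [set X s w | s in `[0, t]] n
    (C * (2 * (tq tw 0)%:R `^ alpha) ^+ n)}.
Proof.
apply: filterS2 (lp_cadlag hX) ae_jumps_bounded => w [hc _] [C hC].
set A := [set X s w | s in `[0, t]].
have AS : A `<=` S0 tw.
  by move=> _ [s /= + <-]; rewrite in_itv/= => /andP[s0 _]; exact: (lp_values hX w s0).
have C0 : 0 <= C.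
  have [j _] := hC 0%N; apply: le_trans.
  by apply: sumr_ge0 => p _; rewrite mulr_ge0// ltW.
(* The 1 accounts for the starting coset, one more than the number of jumps. At index 0 all points
   of [S0] are equivalent, so a family has at most one member. *)
exists (1 + C) => -[|n] I y yA yinj.
  rewrite expr0 mulr1 (@le_trans _ _ 1) ?lerDl//.
  rewrite lern1; apply/card_le1_eqP => i j _ _; apply: yinj.
  by apply: (S0_subgroup tw).2; exact: AS.
have /choice[jk hjk] i : exists p : nat * nat, (p.2 <= 2 ^ p.1)%N /\
    Ssub tw n.+1 (X (grid t p.1 p.2) w - y i).
  have [s /= + <-] := yA i; rewrite in_itv/= => st.
  by have [j [k h]] := right_continuous_dyadic n.+1 hc st; exists (j, k).
(* [j] must exceed [n], for level [n] to occur in [F j], and must refine every grid used by the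
   family. *)
have [j j0j Fj] := hC (n.+1 + \max_i (jk i).1)%N.
have nj : (n < j)%N by apply: leq_trans j0j; rewrite leq_addr.
have ij i : ((jk i).1 <= j)%N.
  apply: leq_trans j0j.
  by rewrite (leq_trans (leq_bigmax (F := fun i => (jk i).1) i))// leq_addl.
pose z k := X (grid t j k) w.
pose kap i := ((jk i).2 * 2 ^ (j - (jk i).1))%N.
have zkap i : Ssub tw n.+1 (z (kap i) - y i).
  by rewrite /z /kap -grid_refine//; exact: (hjk i).2.
have hS := Ssub_subgroup tw n.+1.
have card_le : (#|I| <= (\sum_(0 <= k < 2 ^ j) jump (Ssub tw n.+1) z k).+1)%N.
  apply: (card_cosets_le_jumps hS (kap := kap)) => [i|i i' Sii'].
    by rewrite /kap -{2}(subnKC (ij i)) expnD leq_mul2r (hjk i).1 orbT.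
  apply: yinj; have -> : y i - y i' = (z (kap i) - z (kap i')) -
      ((z (kap i) - y i) - (z (kap i') - y i')).
    by rewrite (subrACA (z (kap i)) (y i)) subKr.
  by apply: hS.2 => //; exact: hS.2.
have wtle : wt n * (\sum_(0 <= k < 2 ^ j) jump (Ssub tw n.+1) z k)%:R <= C.
  apply: le_trans Fj; rewrite /F -(pair_bigA _ (fun (i : 'I_j) (k : 'I_(2 ^ j)) =>
    wt i * \1_(E i (grid t j k) (grid t j k.+1)) w))/=.
  rewrite (bigD1 (Ordinal nj))//= -[leLHS]addr0 lerD//; last first.
    by apply: sumr_ge0 => i _; apply: sumr_ge0 => k _; rewrite mulr_ge0// ltW.
  rewrite -mulr_sumr ler_wpM2l ?(ltW (wt0 _))// big_mkord natr_sum.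
  apply: ler_sum => k _; rewrite indicE /jump le_eqVlt; apply/orP; left.
  apply/eqP; congr (_%:R); congr nat_of_bool.
  apply/idP/idP => [/negP h|/set_mem h]; last by apply/negP => /set_mem.
  by apply/mem_set => h'; apply: h; exact/mem_set.
rewrite (@le_trans _ _ (1 + (\sum_(0 <= k < 2 ^ j) jump (Ssub tw n.+1) z k)%:R))//.
  by rewrite -(natrD R 1) ler_nat add1n.
rewrite mulrDl mul1r lerD//.
  by apply: exprn_ege1; exact: growth_ge1.
(* The weight is undone: [2 ^+ n * c n] is at most the power [n.+1] of [2 * q 0 ^ alpha], because
   [c n] already carries the exponent [n.+1]. *)
move: wtle; rewrite /wt mulrC ler_pdivrMr ?mulr_gt0 ?exprn_gt0// => /le_trans; apply.
rewrite ler_wpM2l// exprMn ler_pM ?exprn_ge0 ?(ltW (c0 n))//.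
  by rewrite ler_weXn2l// ler1n.
rewrite /c -powR_mulrn ?(ltW (tq_gt0 _ _))// -powRrM mulrC powRrM powR_mulrn//.
Qed.

End Range.

Theorem corollary1 (R : realType) (K : fieldType) (tw : tower R K)
  (chi : K -> R[i]) (alpha : R) (mu : R -> probability (Kbar tw) R)
  (d : measure_display) (Omega : measurableType d) (P : probability Omega R)
  (X : R -> Omega -> Kbar tw)
  (hchi : is_rank0_character tw chi)
  (halpha : 0 < alpha)
  (hmu : is_stable_semigroup chi alpha mu)
  (hX : is_levy_process P X)
  (hlaw : forall s : R, 0 < s -> forall A : set (Kbar tw), measurable A ->
     P (X s @^-1` A) = mu s A)
  (t : R) (ht : 0 < t) :
  {ae P, forall w,
     hausdorff_dim (S0 tw) (Sdist tw) [set X s w | s in `[0, t]] = 0%E /\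
     packing_dim (S0 tw) (Sdist tw) [set X s w | s in `[0, t]] = 0%E}.
Proof.
apply: filterS (ae_coset_count hchi halpha hmu hX hlaw ht) => w [C hC].
apply: (thin_dim (SindexE hchi hmu) _ (growth_ge1 tw halpha) hC) => _ [s /= + <-].
by rewrite in_itv/= => /andP[s0 _]; exact: (lp_values hX w s0).
Qed.
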